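(* The category $\mathsf{QCB_0}(\mathbf{HP})$ of hyperprojective qcb$_0$-spaces is cartesian closed, countably complete and countably co-complete. It inherits its exponentials, countable products, countable co-products, equalizers and co-equalizers from $\mathsf{QCB_0}$ (i.e., the corresponding $\mathsf{QCB_0}$-constructions applied to objects of $\mathsf{QCB_0}(\mathbf{HP})$ yield objects of $\mathsf{QCB_0}(\mathbf{HP})$).
   Context: $\mathcal{N}=\omega^\omega$ is the Baire space. A qcb$_0$-space is a $T_0$ topological space which is a topological quotient of a countably based space; $\mathsf{QCB_0}$ is the category of qcb$_0$-spaces and continuous maps, which is cartesian closed, countably complete and countably co-complete. A representation of a space $X$ is a surjection $\delta$ from $\mathit{dom}(\delta)\subseteq\mathcal{N}$ onto $X$; it is admissible if it is continuous and every continuous $\nu\colon Z\to X$ with $Z\subseteq\mathcal{N}$ satisfies $\nu=\delta g$ for some continuous $g\colon Z\to\mathcal{N}$. $\mathit{EQ}(\delta)=\{(p,q)\in\mathcal{N}^2\mid p,q\in\mathit{dom}(\delta),\ \delta(p)=\delta(q)\}$. A family of pointclasses $\mathbf{\Gamma}$ assigns to each topological space $X$ a collection $\mathbf{\Gamma}(X)$ of subsets of $X$, closed under continuous preimages. Operations: $\mathbf{\Gamma}_c(X)$ = complements; $\mathbf{\Gamma}_\delta(X)$ = countable intersections; $\mathbf{\Gamma}_\exists(X)=\{\{x\mid\exists p\in\mathcal{N}.(p,x)\in A\}\mid A\in\mathbf{\Gamma}(\mathcal{N}\times X)\}$; composite subscripts applied left to right. Hyperprojective hierarchy: $\mathbf{\Sigma}^1_0(X)$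 = countable unions of differences of two open sets, $\mathbf{\Sigma}^1_{\alpha+1}=(\mathbf{\Sigma}^1_\alpha)_{c\exists}$, $\mathbf{\Sigma}^1_\lambda=(\mathbf{\Sigma}^1_{<\lambda})_{\delta\exists}$ for limit $\lambda<\omega_1$, where $\mathbf{\Sigma}^1_{<\lambda}(X)=\bigcup_{\alpha<\lambda}\mathbf{\Sigma}^1_\alpha(X)$. $\mathsf{QCB_0}(\mathbf{\Gamma})$ is the class of spaces having an admissible representation $\delta$ with $\mathit{EQ}(\delta)\in\mathbf{\Gamma}(\mathcal{N}^2)$. $\mathsf{QCB_0}(\mathbf{HP})$ is the full subcategory of $\mathsf{QCB_0}$ whose objects are the spaces in $\bigcup_{\alpha<\omega_1}\mathsf{QCB_0}(\mathbf{\Sigma}^1_\alpha)$ (hyperprojective qcb$_0$-spaces). *)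

(* Defs.v *)
From HB Require Import structures.
From mathcomp Require Import all_boot all_classical all_analysis.

Set Implicit Arguments.
Unset Strict Implicit.
Unset Printing Implicit Defensive.

Local Open Scope classical_set_scope.

(** * qcb0-spaces and admissible representations *)

Definition baire : topologicalType := prod_topology (fun _ : nat => nat).

Definition quotient_map (Y X : topologicalType) (q : Y -> X) : Prop :=
  (forall x, exists y, q y = x) /\
  (forall U : set X, open U <-> open (q @^-1` U)).

Definition qcb0 (X : topologicalType) : Prop :=
  kolmogorov_space X /\
  exists (Y : topologicalType) (q : Y -> X),
    @second_countable Y /\ quotient_map q.

(* A partial map on the Baire space is a map on the subtype [D] of its domain,
   which carries the subspace topology.  Unlike a total map on [baire], this
   leaves room for the (empty) representation of the empty space. *)
Definition representation (X : topologicalType) (D : set baire)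
    (delta : D -> X) : Prop :=
  forall x, exists p : D, delta p = x.

Definition admissible (X : topologicalType) (D : set baire)
    (delta : D -> X) : Prop :=
  [/\ representation delta, continuous delta &
      forall (Z : set baire) (nu : Z -> X), continuous nu ->
        exists g : Z -> baire, continuous g /\
          forall z : Z, exists p : D, set_val p = g z /\ nu z = delta p].

Definition EQ (X : topologicalType) (D : set baire) (delta : D -> X) :
    set (baire * baire)%type :=
  [set pq | exists p q : D,
     [/\ set_val p = pq.1, set_val q = pq.2 & delta p = delta q]].

(** * The hyperprojective hierarchy *)

Definition pointclass := forall X : topologicalType, set (set X).

Definition pc_compl (G : pointclass) : pointclass :=
  fun X => [set A | G X (~` A)].

Definition pc_delta (G : pointclass) : pointclass :=
  fun X => [set A | exists B : nat -> set X,
    (forall n, G X (B n)) /\ A = \bigcap_n B n].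

(* [baire * X] carries the product topology *)
Definition pc_exists (G : pointclass) : pointclass :=
  fun X => [set A | exists B : set (baire * X)%type,
    G (baire * X)%type B /\ A = [set x | exists p : baire, B (p, x)]].

Definition Sigma1_0 : pointclass :=
  fun X => [set A | exists U V : nat -> set X,
    (forall n, open (U n) /\ open (V n)) /\ A = \bigcup_n (U n `\` V n)].

(* Every ordinal [alpha < omega_1] is presented as a point of a countable
   well-order, namely by the order type of the set of points below it. *)
Record countable_wellorder := CountableWellorder {
  wo_sort :> countType;
  wo_lt : wo_sort -> wo_sort -> Prop;
  wo_trans : forall a b c, wo_lt a b -> wo_lt b c -> wo_lt a c;
  wo_total : forall a b, wo_lt a b \/ a = b \/ wo_lt b a;
  wo_wf : well_founded wo_lt }.

Section Hierarchy.
Variable W : countable_wellorder.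

Definition wo_zero (a : W) : Prop := forall b, ~ wo_lt b a.

Definition wo_succ (b a : W) : Prop :=
  wo_lt b a /\ forall c, ~ (wo_lt b c /\ wo_lt c a).

Definition wo_limit (a : W) : Prop :=
  ~ wo_zero a /\ forall b, ~ wo_succ b a.

Definition Sigma1_step (a : W) (S : forall b, wo_lt b a -> pointclass) :
    pointclass :=
  fun X => [set A |
    [\/ wo_zero a /\ Sigma1_0 A,
        exists b (ba : wo_lt b a),
          wo_succ b a /\ pc_exists (pc_compl (S b ba)) A |
        wo_limit a /\
        pc_exists (pc_delta
          (fun Y => [set B | exists b (ba : wo_lt b a), S b ba Y B])) A]].

Definition Sigma1 : W -> pointclass :=
  Fix (@wo_wf W) (fun=> pointclass) Sigma1_step.

End Hierarchy.

(** * Classes of spaces, viewed as full subcategories of topological spaces *)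

Definition space_class := topologicalType -> Prop.

Definition qcb0_of (G : pointclass) : space_class := fun X =>
  qcb0 X /\ exists (D : set baire) (delta : D -> X),
    admissible delta /\ G (baire * baire)%type (EQ delta).

Definition qcb0_hp : space_class := fun X =>
  exists (W : countable_wellorder) (a : W), qcb0_of (Sigma1 a) X.

(** ** Universal properties

    For a class [C], the universal properties below are those of the full
    subcategory of topological spaces and continuous maps on the objects in
    [C]: the universal object lies in [C], and so do the test objects [Z].
    The data [X], [Y], ... are to be taken in [C] by the user. *)

Section UniversalProperties.
Variable C : space_class.

Definition is_terminal (T : topologicalType) : Prop :=
  C T /\ forall Z : topologicalType, C Z ->
    exists! h : Z -> T, continuous h.

Definition is_binprod (X Y P : topologicalType) (p1 : P -> X) (p2 : P -> Y) :
    Prop :=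
  [/\ C P, continuous p1, continuous p2 &
      forall (Z : topologicalType) (f : Z -> X) (g : Z -> Y),
        C Z -> continuous f -> continuous g ->
        exists! h : Z -> P, [/\ continuous h, p1 \o h = f & p2 \o h = g]].

Definition is_product (I : countType) (X : I -> topologicalType)
    (P : topologicalType) (p : forall i, P -> X i) : Prop :=
  [/\ C P, forall i, continuous (p i) &
      forall (Z : topologicalType) (f : forall i, Z -> X i),
        C Z -> (forall i, continuous (f i)) ->
        exists! h : Z -> P, continuous h /\ forall i, p i \o h = f i].

Definition is_coproduct (I : countType) (X : I -> topologicalType)
    (S : topologicalType) (s : forall i, X i -> S) : Prop :=
  [/\ C S, forall i, continuous (s i) &
      forall (Z : topologicalType) (f : forall i, X i -> Z),
        C Z -> (forall i, continuous (f i)) ->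
        exists! h : S -> Z, continuous h /\ forall i, h \o s i = f i].

Definition is_equalizer (X Y : topologicalType) (f g : X -> Y)
    (E : topologicalType) (e : E -> X) : Prop :=
  [/\ C E, continuous e, f \o e = g \o e &
      forall (Z : topologicalType) (k : Z -> X),
        C Z -> continuous k -> f \o k = g \o k ->
        exists! h : Z -> E, continuous h /\ e \o h = k].

Definition is_coequalizer (X Y : topologicalType) (f g : X -> Y)
    (Q : topologicalType) (q : Y -> Q) : Prop :=
  [/\ C Q, continuous q, q \o f = q \o g &
      forall (Z : topologicalType) (k : Y -> Z),
        C Z -> continuous k -> k \o f = k \o g ->
        exists! h : Q -> Z, continuous h /\ h \o q = k].

(* [E] is the exponential [Y^X], with evaluation [ev : E x X -> Y].  Products
   are those of the category [C], which need not be topological products;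
   hence [E x X] and [Z x X] are given by the product cones
   [(P, p1, p2)] and [(Q, q1, q2)], and [k] is the morphism [h x id_X]. *)
Definition is_exponential (X Y E P : topologicalType)
    (p1 : P -> E) (p2 : P -> X) (ev : P -> Y) : Prop :=
  [/\ C E, is_binprod p1 p2, continuous ev &
      forall (Z Q : topologicalType) (q1 : Q -> Z) (q2 : Q -> X) (f : Q -> Y),
        C Z -> is_binprod q1 q2 -> continuous f ->
        exists! h : Z -> E, continuous h /\
          exists k : Q -> P,
            [/\ continuous k, p1 \o k = h \o q1, p2 \o k = q2 & ev \o k = f]].

Definition cartesian_closed : Prop :=
  [/\ exists T : topologicalType, is_terminal T,
      forall X Y : topologicalType, C X -> C Y ->
        exists (P : topologicalType) (p1 : P -> X) (p2 : P -> Y),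
          is_binprod p1 p2 &
      forall X Y : topologicalType, C X -> C Y ->
        exists (E P : topologicalType) (p1 : P -> E) (p2 : P -> X)
               (ev : P -> Y), is_exponential p1 p2 ev].

End UniversalProperties.

(** ** Countable limits and colimits *)

Record countable_category := CountableCategory {
  cc_ob :> countType;
  cc_hom : cc_ob -> cc_ob -> countType;
  cc_id : forall i, cc_hom i i;
  cc_comp : forall i j k, cc_hom j k -> cc_hom i j -> cc_hom i k;
  cc_idl : forall i j (u : cc_hom i j), cc_comp (cc_id j) u = u;
  cc_idr : forall i j (u : cc_hom i j), cc_comp u (cc_id i) = u;
  cc_assoc : forall i j k l (w : cc_hom k l) (v : cc_hom j k) (u : cc_hom i j),
    cc_comp w (cc_comp v u) = cc_comp (cc_comp w v) u }.

Record diagram (J : countable_category) := Diagram {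
  dg_ob :> J -> topologicalType;
  dg_map : forall i j : J, cc_hom i j -> dg_ob i -> dg_ob j;
  dg_cont : forall (i j : J) (u : cc_hom i j), continuous (dg_map u);
  dg_id : forall i : J, dg_map (cc_id i) = id;
  dg_comp : forall (i j k : J) (v : cc_hom j k) (u : cc_hom i j),
    dg_map (cc_comp v u) = dg_map v \o dg_map u }.

Section Limits.
Variables (C : space_class) (J : countable_category) (F : diagram J).

Definition is_cone (Z : topologicalType) (f : forall i : J, Z -> F i) : Prop :=
  (forall i, continuous (f i)) /\
  forall (i j : J) (u : cc_hom i j), dg_map u \o f i = f j.

Definition is_cocone (Z : topologicalType) (f : forall i : J, F i -> Z) :
    Prop :=
  (forall i, continuous (f i)) /\
  forall (i j : J) (u : cc_hom i j), f j \o dg_map u = f i.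

Definition is_limit (L : topologicalType) (p : forall i : J, L -> F i) : Prop :=
  [/\ C L, is_cone p &
      forall (Z : topologicalType) (f : forall i : J, Z -> F i),
        C Z -> is_cone f ->
        exists! h : Z -> L, continuous h /\ forall i, p i \o h = f i].

Definition is_colimit (L : topologicalType) (s : forall i : J, F i -> L) :
    Prop :=
  [/\ C L, is_cocone s &
      forall (Z : topologicalType) (f : forall i : J, F i -> Z),
        C Z -> is_cocone f ->
        exists! h : L -> Z, continuous h /\ forall i, h \o s i = f i].

End Limits.

Definition countably_complete (C : space_class) : Prop :=
  forall (J : countable_category) (F : diagram J), (forall i, C (F i)) ->
  exists (L : topologicalType) (p : forall i : J, L -> F i), is_limit C p.

Definition countably_cocomplete (C : space_class) : Prop :=
  forall (J : countable_category) (F : diagram J), (forall i, C (F i)) ->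
  exists (L : topologicalType) (s : forall i : J, F i -> L), is_colimit C s.

(** ** Inheritance of constructions

    [C] inherits a construction from [D] if, on data in [C], the construction
    exists in [D] and whatever it yields in [D] lies in [C] and is the
    corresponding construction in [C]. *)

Section Inheritance.
Variables C D : space_class.

Definition inherits_exponentials : Prop :=
  forall X Y : topologicalType, C X -> C Y ->
  (exists (E P : topologicalType) (p1 : P -> E) (p2 : P -> X) (ev : P -> Y),
     is_exponential D p1 p2 ev) /\
  (forall (E P : topologicalType) (p1 : P -> E) (p2 : P -> X) (ev : P -> Y),
     is_exponential D p1 p2 ev -> is_exponential C p1 p2 ev).

Definition inherits_countable_products : Prop :=
  forall (I : countType) (X : I -> topologicalType), (forall i, C (X i)) ->
  (exists (P : topologicalType) (p : forall i, P -> X i), is_product D p) /\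
  (forall (P : topologicalType) (p : forall i, P -> X i),
     is_product D p -> is_product C p).

Definition inherits_countable_coproducts : Prop :=
  forall (I : countType) (X : I -> topologicalType), (forall i, C (X i)) ->
  (exists (S : topologicalType) (s : forall i, X i -> S), is_coproduct D s) /\
  (forall (S : topologicalType) (s : forall i, X i -> S),
     is_coproduct D s -> is_coproduct C s).

Definition inherits_equalizers : Prop :=
  forall (X Y : topologicalType) (f g : X -> Y), C X -> C Y ->
  continuous f -> continuous g ->
  (exists (E : topologicalType) (e : E -> X), is_equalizer D f g e) /\
  (forall (E : topologicalType) (e : E -> X),
     is_equalizer D f g e -> is_equalizer C f g e).

Definition inherits_coequalizers : Prop :=
  forall (X Y : topologicalType) (f g : X -> Y), C X -> C Y ->
  continuous f -> continuous g ->
  (exists (Q : topologicalType) (q : Y -> Q), is_coequalizer D f g q) /\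
  (forall (Q : topologicalType) (q : Y -> Q),
     is_coequalizer D f g q -> is_coequalizer C f g q).

End Inheritance.

(* Main.v *)
From HB Require Import structures.
From mathcomp Require Import all_boot all_classical all_analysis.
Require Import Defs.

(** A qcb0-space is handled through the relation "[p] names [x]" of a
    representation whose final topology is the given one.  The hyperprojective
    sets are closed under complements, countable intersections, projections
    along the Baire space and continuous preimages, so a construction stays in
    the class as soon as equality of names is described by a formula with
    quantifiers over the Baire space.

    Any quotient representation of a T0-space can be made admissible inside
    the class: name a point by a code of its neighbourhood filter, that is, in
    the double dual of the space.  This handles colimits, which are
    Kolmogorov quotients of spaces of names.  Limits are named componentwise,
    and exponentials by associates of realizers.  The one analytic point, both
    for the double dual and for exponentials, is that evaluation is open along
    continuous maps that are not yet known to lift to names; it follows from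
    the compactness of a convergent sequence with its limit.

    The same constructions apply to the class of all qcb0-spaces, so
    uniqueness of universal objects transfers membership to any of them. *)

Set Implicit Arguments.
Unset Strict Implicit.
Unset Printing Implicit Defensive.

Local Open Scope classical_set_scope.

(** * Closure properties of the hyperprojective sets *)

Section HierarchyTheory.
Variable W : countable_wellorder.
Implicit Types a b c : W.

Lemma Sigma1P a (X : topologicalType) (A : set X) :
  Sigma1 a A <->
  [\/ wo_zero a /\ Sigma1_0 A,
      exists b, wo_succ b a /\ pc_exists (pc_compl (Sigma1 b)) A |
      wo_limit a /\
      pc_exists (pc_delta
        (fun Y => [set B | exists b, wo_lt b a /\ Sigma1 b B])) A].
Proof.
have E : Sigma1 a = @Sigma1_step W a (fun b _ => Sigma1 b).
  apply: Init.Wf.Fix_eq => x f g fg.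
  by congr Sigma1_step; apply: functional_extensionality_dep => y;
    apply: functional_extensionality_dep => p; exact: fg.
rewrite E /Sigma1_step /=.
pose L (Y : topologicalType) (B : set Y) :=
  exists b (_ : wo_lt b a), Sigma1 b B.
have LE : L = (fun Y => [set B | exists b, wo_lt b a /\ Sigma1 b B]).
  apply: functional_extensionality_dep => Y.
  by apply/seteqP; split=> B [b] => [[ba h]|[ba h]]; exists b => //; exists ba.
rewrite -[X in pc_delta X]/L -LE.
split=> -[h|h|h].
- by apply: Or31.
- by case: h => b [ba [bs h]]; apply: Or32; exists b.
- by apply: Or33.
- by apply: Or31.
- case: h => b [bs h]; apply: Or32; exists b.
  by exists (proj1 bs).
- by apply: Or33.
Qed.

Lemma wo_cases a : [\/ wo_zero a, exists b, wo_succ b a | wo_limit a].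
Proof.
have [z|nz] := pselect (wo_zero a); first by apply: Or31.
have [s|ns] := pselect (exists b, wo_succ b a); first by apply: Or32.
by apply: Or33; split=> // b sb; apply: ns; exists b.
Qed.

Lemma wo_irr a : ~ wo_lt a a.
Proof. by elim/(well_founded_ind (@wo_wf W)): a => a IH aa; exact: (IH a). Qed.

Lemma Sigma1_0_preimage (X Y : topologicalType) (f : X -> Y) (A : set Y) :
  continuous f -> Sigma1_0 A -> Sigma1_0 (f @^-1` A).
Proof.
move=> /continuousP cf [U [V [UV ->]]].
exists (fun n => f @^-1` U n), (fun n => f @^-1` V n); split.
  by move=> n; have [oU oV] := UV n; split; exact: cf.
by rewrite preimage_bigcup.
Qed.

Lemma prod_map_continuous (X X' Y Y' : topologicalType) (f : X -> X')
    (g : Y -> Y') : continuous f -> continuous g ->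
  continuous (fun p : X * Y => (f p.1, g p.2)).
Proof.
move=> cf cg p; apply: cvg_pair.
  by apply: (@continuous_comp _ _ _ fst f); [exact: cvg_fst|exact: cf].
by apply: (@continuous_comp _ _ _ snd g); [exact: cvg_snd|exact: cg].
Qed.

Lemma idfun_continuous (X : topologicalType) : continuous (@idfun X).
Proof. by move=> x. Qed.

Lemma Sigma1_preimage a (X Y : topologicalType) (f : X -> Y) (A : set Y) :
  continuous f -> Sigma1 a A -> Sigma1 a (f @^-1` A).
Proof.
elim/(well_founded_ind (@wo_wf W)): a X Y f A => a IH X Y f A cf.
have cg := prod_map_continuous (@idfun_continuous baire) cf.
move=> /Sigma1P[[z SA]|[b [sb [B [SB ->]]]]|[l [B [[C [SC ->]] ->]]]]; apply/Sigma1P.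
- by apply: Or31; split=> //; exact: Sigma1_0_preimage.
- apply: Or32; exists b; split=> //.
  exists ((fun p : baire * X => (p.1, f p.2)) @^-1` B); split=> //.
  by rewrite /pc_compl /= preimage_setC; apply: IH => //; case: sb.
- apply: Or33; split=> //.
  exists ((fun p : baire * X => (p.1, f p.2)) @^-1` \bigcap_n C n); split=> //.
  exists (fun n => (fun p : baire * X => (p.1, f p.2)) @^-1` C n); split.
    by move=> n; have [b [ba Sb]] := SC n; exists b; split=> //; exact: IH.
  by rewrite preimage_bigcap.
Qed.

Lemma baire_coord_open (X : topologicalType) n :
  open [set p : baire * X | p.1 0 = n].
Proof.
have /continuousP c : continuous (fun p : baire * X => p.1 0).
  move=> p; apply: (@continuous_comp _ _ _ fst (fun q : baire => q 0)).
    exact: cvg_fst.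
  exact: (@proj_continuous nat (fun=> nat) 0).
have := c [set n].
by apply; rewrite openE => m -> ; rewrite /interior nbhs_principalE.
Qed.

(* A countable union becomes a projection along the first coordinate of the
   Baire space, which leaves a set whose complement is again [Sigma1_0]. *)
Lemma Sigma1_0_proj (X : topologicalType) (A : set X) : Sigma1_0 A ->
  exists B : set (baire * X)%type,
    Sigma1_0 (~` B) /\ A = [set x | exists p, B (p, x)].
Proof.
move=> [U [V [UV ->]]].
exists [set px | (U (px.1 0) `\` V (px.1 0)) px.2]; split; last first.
  apply/seteqP; split=> x /=; first by move=> [n _ h]; exists (fun=> n).
  by move=> [p h]; exists (p 0).
have /continuousP cs : continuous (snd : baire * X -> X) by move=> p; exact: cvg_snd.
pose E n := [set p : baire * X | p.1 0 = n].
exists (fun m => if odd m then E m./2 `&` snd @^-1` V m./2 else E m./2),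
       (fun m => if odd m then set0 else snd @^-1` U m./2); split.
  move=> m; have [oU oV] := UV m./2; case: ifP => _; split.
  - by apply: openI; [exact: baire_coord_open|exact: cs].
  - exact: open0.
  - exact: baire_coord_open.
  - exact: cs.
apply/seteqP; split=> -[p x] /=.
  move=> h; have [Vx|nVx] := pselect (V (p 0) x).
    by exists (p 0).*2.+1 => //; rewrite oddS odd_double /= uphalf_double; do !split=> //; case.
  exists (p 0).*2 => //; rewrite odd_double doubleK; split=> //= Ux.
  exact: h.
move=> [m _]; case: ifP => _.
  by move=> [[pm Vx] _] [_]; apply; rewrite (_ : p 0 = m./2).
by move=> [pm nU] [Ux _]; apply: nU; rewrite /= -(_ : p 0 = m./2).
Qed.

Lemma Sigma1_zero a (X : topologicalType) (A : set X) :
  Sigma1_0 A -> Sigma1 a A.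
Proof.
elim/(well_founded_ind (@wo_wf W)): a X A => a IH X A SA; apply/Sigma1P.
have [z|[b sb]|l] := wo_cases a; first by apply: Or31.
- apply: Or32; exists b; split=> //.
  have [B [SB AB]] := Sigma1_0_proj SA; exists B; split=> //.
  by apply: IH => //; case: sb.
- apply: Or33; split=> //.
  have [b ba] : exists b, wo_lt b a.
    by case: l => nz _; apply: contrapT => h; apply: nz => b ba; apply: h; exists b.
  have cs : continuous (snd : baire * X -> X) by move=> p; exact: cvg_snd.
  exists (snd @^-1` A); split; last first.
    by apply/seteqP; split=> x /=; [exists point|case].
  exists (fun=> snd @^-1` A); split; last by rewrite bigcap_const.
  by move=> _; exists b; split=> //; apply: IH => //; exact: Sigma1_0_preimage.
Qed.

Lemma Sigma1_compl b a (X : topologicalType) (A : set X) :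
  wo_succ b a -> Sigma1 b A -> Sigma1 a (~` A).
Proof.
move=> sb SA; apply/Sigma1P; apply: Or32; exists b; split=> //.
have cs : continuous (snd : baire * X -> X) by move=> p; exact: cvg_snd.
exists (snd @^-1` (~` A)); split; last first.
  by apply/seteqP; split=> x /=; [exists point|case].
by rewrite /pc_compl /= preimage_setC setCK; exact: Sigma1_preimage.
Qed.

Lemma Sigma1_proj b a (X : topologicalType) (B : set (baire * X)%type) :
  wo_succ b a -> Sigma1 b (~` B) -> Sigma1 a [set x | exists p, B (p, x)].
Proof. by move=> sb SA; apply/Sigma1P; apply: Or32; exists b; split=> //; exists B. Qed.

Lemma Sigma1_bigcap a (X : topologicalType) (A : nat -> set X) :
  wo_limit a -> (forall n, exists b, wo_lt b a /\ Sigma1 b (A n)) ->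
  Sigma1 a (\bigcap_n A n).
Proof.
move=> l SA; apply/Sigma1P; apply: Or33; split=> //.
have cs : continuous (snd : baire * X -> X) by move=> p; exact: cvg_snd.
exists (snd @^-1` (\bigcap_n A n)); split; last first.
  by apply/seteqP; split=> x /=; [exists point|case].
exists (fun n => snd @^-1` A n); split; last by rewrite preimage_bigcap.
move=> n; have [b [ba Sb]] := SA n.
by exists b; split=> //; exact: Sigma1_preimage.
Qed.

End HierarchyTheory.

Lemma Sigma1_transport (W W' : countable_wellorder) (R : W -> W' -> Prop) :
  (forall b a a', R a a' -> wo_succ b a -> exists b', wo_succ b' a' /\ R b b') ->
  (forall a a', R a a' -> wo_limit a -> wo_limit a') ->
  (forall b a a', R a a' -> wo_lt b a -> exists b', wo_lt b' a' /\ R b b') ->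
  forall a a' (X : topologicalType) (A : set X),
    R a a' -> Sigma1 a A -> Sigma1 a' A.
Proof.
move=> Rs Rl Rlt a; elim/(well_founded_ind (@wo_wf W)): a => a IH a' X A aa'.
move=> /Sigma1P[[z SA]|[b [sb [B [SB ->]]]]|[l [B [[C [SC ->]] ->]]]].
- exact: Sigma1_zero.
- have [b' [sb' bb']] := Rs _ _ _ aa' sb.
  by apply: (Sigma1_proj sb'); apply: (IH b) => //; case: sb.
- apply/Sigma1P; apply: Or33; split; first exact: Rl aa' l.
  exists (\bigcap_n C n); split=> //; exists C; split=> // n.
  have [b [ba Sb]] := SC n; have [b' [ba' bb']] := Rlt _ _ _ aa' ba.
  by exists b'; split=> //; exact: IH bb' Sb.
Qed.

Section WoSum.
Variable V : nat -> countable_wellorder.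

Inductive sum_lt : {n : nat & V n} -> {n : nat & V n} -> Prop :=
| SumLtIdx m n (x : V m) (y : V n) : m < n -> sum_lt (Tagged V x) (Tagged V y)
| SumLtVal n (x y : V n) : wo_lt x y -> sum_lt (Tagged V x) (Tagged V y).

Lemma sum_ltP n (x : V n) u : sum_lt u (Tagged V x) ->
  tag u < n \/ exists y, u = Tagged V y /\ wo_lt y x.
Proof.
have H v : sum_lt u v -> tag u < tag v \/
    exists k (a b : V k), [/\ u = Tagged V a, v = Tagged V b & wo_lt a b].
  by case=> [m k a b mk|k a b ab]; [left|right; exists k, a, b].
move=> /H [un|[k [a [b [-> E ab]]]]]; first by left.
right; have Ek := congr1 tag E; rewrite /= in Ek; subst k.
by exists a; split=> //; move/eqP: E; rewrite eq_Tagged => /eqP /= ->.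
Qed.

Lemma sum_trans a b c : sum_lt a b -> sum_lt b c -> sum_lt a c.
Proof.
case: c => k c ab /sum_ltP[|[b' [Eb bc]]].
  case: b ab => j b /sum_ltP[|[a' [-> _]]] /=; last exact: SumLtIdx.
  by case: a => i a /= ij jk; apply: SumLtIdx; exact: ltn_trans jk.
subst b; case/sum_ltP: ab => [|[a' [-> ab]]].
  by case: a => i a /= ik; exact: SumLtIdx.
by apply: SumLtVal; exact: wo_trans bc.
Qed.

Lemma sum_total a b : sum_lt a b \/ a = b \/ sum_lt b a.
Proof.
case: a b => [i a] [j b]; have [ij|ji|ij] := ltngtP i j.
- by left; apply: SumLtIdx.
- by right; right; apply: SumLtIdx.
- subst j; have [ab|[->|ba]] := wo_total a b; [left|by right; left|right; right].
    exact: SumLtVal.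
  exact: SumLtVal.
Qed.

Lemma sum_wf : well_founded sum_lt.
Proof.
have H n : forall x : V n, Acc sum_lt (Tagged V x).
  elim/ltn_ind: n => n IH x.
  elim/(well_founded_ind (@wo_wf (V n))): x => x IHx.
  constructor=> -[m u] /sum_ltP[/= mn|[y [-> yx]]]; [exact: IH|exact: IHx].
by move=> [n x]; exact: H.
Qed.

Definition wo_sum : countable_wellorder :=
  CountableWellorder sum_trans sum_total sum_wf.

Lemma Sigma1_sum n (a : V n) (X : topologicalType) (A : set X) :
  Sigma1 a A -> Sigma1 (Tagged V a : wo_sum) A.
Proof.
apply: (@Sigma1_transport _ wo_sum (fun a b => b = Tagged V a)) => //.
- move=> b {}a _ -> [ba nb]; exists (Tagged V b); split=> //; split.
    exact: SumLtVal.
  move=> c [bc /sum_ltP[/= cn|[y [E ya]]]].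
    case: c bc cn => k c /sum_ltP[/= nk|[y [E _]]] /= kn.
      by rewrite ltnNge (ltnW nk) in kn.
    by have /= nk := congr1 tag E; rewrite nk ltnn in kn.
  subst c; case/sum_ltP: bc => [/=|[z [/eqP]]]; first by rewrite ltnn.
  by rewrite eq_Tagged => /eqP /= <- zy; exact: (nb y).
- move=> {}a _ -> [nz ns]; split.
    move=> z; apply: nz => b ba; apply: (z (Tagged V b)); exact: SumLtVal.
  move=> b [/sum_ltP[bn|[y [E ya]]] h].
    apply: nz => y ya; apply: (h (Tagged V y)); split; last exact: SumLtVal.
    by case: b bn h => k b /= kn _; exact: SumLtIdx.
  subst b; apply: (ns y); split=> // c [yc ca]; apply: (h (Tagged V c)).
  by split; exact: SumLtVal.
- by move=> b {}a _ -> ba; exists (Tagged V b); split=> //; exact: SumLtVal.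
Qed.

End WoSum.

Section WoTop.
Variable W : countable_wellorder.

Definition top_lt (a b : option W) : Prop :=
  match a, b with
  | Some x, Some y => wo_lt x y
  | Some _, None => True
  | None, _ => False
  end.

Lemma top_trans a b c : top_lt a b -> top_lt b c -> top_lt a c.
Proof. by case: a b c => [a|] [b|] [c|] //=; exact: wo_trans. Qed.

Lemma top_total a b : top_lt a b \/ a = b \/ top_lt b a.
Proof.
case: a b => [a|] [b|] /=; [|by left|by right; right|by right; left].
by have [h|[->|h]] := wo_total a b; [left|right; left|right; right].
Qed.

Lemma top_wf : well_founded top_lt.
Proof.
have Ha (a : W) : Acc top_lt (Some a).
  elim: (wo_wf a) => {}a _ IH.
  by apply: Acc_intro => -[b|] ba; [exact: IH|case: ba].
by move=> [a|]; [exact: Ha|apply: Acc_intro => -[b|] ba; [exact: Ha|case: ba]].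
Qed.

Definition wo_top : countable_wellorder :=
  CountableWellorder top_trans top_total top_wf.

Lemma Sigma1_top (a : W) (X : topologicalType) (A : set X) :
  Sigma1 a A -> Sigma1 (Some a : wo_top) A.
Proof.
apply: (@Sigma1_transport _ wo_top (fun a b => b = Some a)) => //.
- move=> b {}a _ -> [ba nb]; exists (Some b); split=> //; split=> // -[c|] [] //= bc ca.
  exact: (nb c).
- move=> {}a _ -> [nz ns]; split.
    by move=> z; apply: nz => b ba; apply: (z (Some b)).
  by move=> [b|] [] //= ba h; apply: (ns b); split=> // c [bc ca]; apply: (h (Some c)).
- by move=> b {}a _ -> ba; exists (Some b).
Qed.

End WoTop.

Section WoBelow.
Variables (W : countable_wellorder) (a : W).

Let below : Type := {b : W | `[< b = a \/ wo_lt b a >]}.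

Definition below_lt (b c : below) : Prop := wo_lt (val b) (val c).

Lemma below_trans b c d : below_lt b c -> below_lt c d -> below_lt b d.
Proof. exact: wo_trans. Qed.

Lemma below_total b c : below_lt b c \/ b = c \/ below_lt c b.
Proof.
have [h|[/val_inj->|h]] := wo_total (val b) (val c);
  by [left|right; left|right; right].
Qed.

Lemma below_wf : well_founded below_lt.
Proof.
move=> b; move Ex: (val b) => x; elim/(well_founded_ind (@wo_wf W)): x b Ex.
move=> x IH b Ex; constructor=> c; rewrite /below_lt Ex => cx.
exact: (IH (val c)).
Qed.

Definition wo_below : countable_wellorder :=
  CountableWellorder below_trans below_total below_wf.

Definition below_max : wo_below := exist _ a (asboolT (or_introl (erefl a))).

Lemma below_max_max (b : wo_below) : ~ wo_lt below_max b.
Proof.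
case: b => b pb /= ab; have := ab; rewrite /below_lt /=.
have /asboolP [->|ba] := pb; first exact: wo_irr.
by move=> /(wo_trans ba); exact: wo_irr.
Qed.

Lemma Sigma1_below (X : topologicalType) (A : set X) :
  Sigma1 a A -> Sigma1 below_max A.
Proof.
have lift (c b : W) (b' : wo_below) : b = val b' -> wo_lt c b ->
    exists c' : wo_below, c = val c'.
  move=> -> cb; have p : `[< c = a \/ wo_lt c a >].
    apply/asboolP; right; case: b' cb => b' /= /asboolP[->//|ba] cb.
    exact: wo_trans ba.
  by exists (exist _ c p).
apply: (@Sigma1_transport _ wo_below (fun a b => a = val b)) => //.
- move=> b c c' cc' [bc nb]; have [b' bb'] := lift _ _ _ cc' bc.
  exists b'; split=> //; split; first by rewrite /= /below_lt -bb' -cc'.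
  by move=> d /=; rewrite /below_lt -bb' -cc'; exact: nb.
- move=> c c' cc' [nz ns]; split.
    move=> z; apply: nz => b bc; have [b' bb'] := lift _ _ _ cc' bc.
    by apply: (z b'); rewrite /= /below_lt -bb' -cc'.
  move=> b' []; rewrite /= /below_lt -cc' => ba h; apply: (ns (val b')); split=> //.
  move=> d [bd dc]; have [d' dd'] := lift _ _ _ cc' dc.
  by apply: (h d'); move: bd dc; rewrite dd' cc'.
- move=> b c c' cc' bc; have [b' bb'] := lift _ _ _ cc' bc.
  by exists b'; split=> //; move: bc; rewrite bb' cc'.
Qed.

End WoBelow.

(** * Pointclasses closed under the projective operations *)

Record closed_pointclass (G : pointclass) : Prop := ClosedPointclass {
  pcl_open : forall (X : topologicalType) (A : set X), open A -> G X A;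
  pcl_compl : forall (X : topologicalType) (A : set X), G X A -> G X (~` A);
  pcl_bigcap : forall (X : topologicalType) (A : nat -> set X),
    (forall n, G X (A n)) -> G X (\bigcap_n A n);
  pcl_exists : forall (X : topologicalType) (B : set (baire * X)%type),
    G _ B -> G X [set x | exists p, B (p, x)];
  pcl_preimage : forall (X Y : topologicalType) (f : X -> Y) (A : set Y),
    continuous f -> G Y A -> G X (f @^-1` A) }.

Definition hyperprojective : pointclass := fun X =>
  [set A | exists (W : countable_wellorder) (a : W), Sigma1 a A].

Lemma top_below_succ (W : countable_wellorder) (a : W) :
  @wo_succ (wo_top (wo_below a)) (Some (below_max a)) None.
Proof. by split=> // -[c|] [h1 h2]; [exact: below_max_max h1|case: h2]. Qed.

Lemma top_sum_limit (V : nat -> countable_wellorder) (a : forall n, V n) :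
  @wo_limit (wo_top (wo_sum V)) None.
Proof.
split; first by move=> z; apply: (z (Some (Tagged V (a 0)))).
move=> [[n b]|] [] //= _ h; apply: (h (Some (Tagged V (a n.+1)))).
by split=> //; exact: SumLtIdx.
Qed.

Lemma hyperprojective_compl (X : topologicalType) (A : set X) :
  hyperprojective A -> hyperprojective (~` A).
Proof.
move=> [W [a SA]]; exists (wo_top (wo_below a)), None.
by apply: (Sigma1_compl (@top_below_succ _ a)); apply: Sigma1_top; exact: Sigma1_below.
Qed.

Definition wo_one : countable_wellorder.
Proof.
apply: (@CountableWellorder unit (fun _ _ => False)) => //.
  by move=> [] []; right; left.
Defined.

Lemma hyperprojective_closed : closed_pointclass hyperprojective.
Proof.
split.
- move=> X A oA; exists wo_one, tt; apply: Sigma1_zero.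
  exists (fun=> A), (fun=> set0); split; last by rewrite setD0 bigcup_const.
  by move=> _; split=> //; exact: open0.
- exact: hyperprojective_compl.
- move=> X A hA.
  pose W n := projT1 (cid (hA n)); pose a n := projT1 (cid (projT2 (cid (hA n)))).
  have SA n : Sigma1 (a n) (A n) := projT2 (cid (projT2 (cid (hA n)))).
  exists (wo_top (wo_sum (fun n => W n))), None.
  apply: Sigma1_bigcap; first exact: top_sum_limit a.
  move=> n; exists (Some (Tagged (fun n => W n) (a n))); split=> //.
  apply: (@Sigma1_top (wo_sum (fun n => W n))); exact: (@Sigma1_sum (fun n => W n)) (SA n).
- move=> X B /hyperprojective_compl [W [a SA]].
  exists (wo_top (wo_below a)), None.
  by apply: (Sigma1_proj (@top_below_succ _ a)); apply: Sigma1_top; exact: Sigma1_below.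
- move=> X Y f A cf [W [a SA]]; exists W, a; exact: Sigma1_preimage.
Qed.

(** * The Baire space *)

Definition agree k (p q : baire) : Prop := forall i, i < k -> p i = q i.

Lemma agree_refl k p : agree k p p. Proof. by []. Qed.

Lemma agree_sym k p q : agree k p q -> agree k q p.
Proof. by move=> pq i /pq. Qed.

Lemma agree_trans k p q r : agree k p q -> agree k q r -> agree k p r.
Proof. by move=> pq qr i ik; rewrite pq ?qr. Qed.

Lemma agree_le j k p q : j <= k -> agree k p q -> agree j p q.
Proof. by move=> jk pq i ij; apply: pq; exact: leq_trans jk. Qed.

Lemma agree_max j k p q :
  agree (maxn j k) p q <-> agree j p q /\ agree k p q.
Proof.
split=> [h|[h1 h2] i]; last by rewrite leq_max => /orP[/h1|/h2].
by split; apply: agree_le h; rewrite ?leq_maxl ?leq_maxr.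
Qed.

Lemma agree_mkseq k p q : agree k p q <-> mkseq q k = mkseq p k.
Proof.
split=> h; first by apply/eq_in_map => i; rewrite mem_iota => /h.
by move=> i ik; rewrite -(nth_mkseq 0 p ik) -h nth_mkseq.
Qed.

Lemma agree_prefix k p q : agree k p q -> mkseq q k = mkseq p k.
Proof. by move/agree_mkseq. Qed.

Lemma uniform_bound (P : nat -> nat -> Prop) :
  (forall n j k, j <= k -> P n j -> P n k) -> (forall n, exists k, P n k) ->
  forall m, exists k, forall n, n < m -> P n k.
Proof.
move=> mono ex; elim=> [|m [k hk]]; first by exists 0.
have [j hj] := ex m; exists (maxn j k) => n; rewrite ltnS leq_eqVlt.
case/orP=> [/eqP->|/hk h]; first exact: mono (leq_maxl _ _) hj.
exact: mono (leq_maxr _ _) h.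
Qed.

Lemma nbhs_baire (p : baire) (A : set baire) :
  nbhs p A <-> exists k, forall q, agree k p q -> A q.
Proof.
split=> [|[k]]; last first.
  elim: k A => [|k IH] A h; first by apply: filterE => q; exact: h.
  have /IH : forall q, agree k p q -> [set q | agree k p q] q by [].
  have c := @proj_continuous nat (fun=> nat) k p [set p k] _.
  move=> h1; apply: filterS (filterI h1 (c _)).
    move=> q [pq /= qk]; apply: h => i; rewrite ltnS leq_eqVlt => /orP[/eqP->|].
      by rewrite -qk.
    exact: pq.
  by rewrite nbhs_principalE.
pose F : set_system baire := [set B | exists k, forall q, agree k p q -> B q].
have FF : Filter F.
  split; first by exists 0.
    move=> B C [j hj] [k hk]; exists (maxn j k) => q /agree_max[? ?].
    by split; [exact: hj|exact: hk].
  by move=> B C BC [j hj]; exists j => q /hj /BC.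
suff : F --> p by apply.
apply/cvg_sup => i B [C [[D oD <-] Cp CB]].
by exists i.+1 => q pq; apply: CB; rewrite /= /proj -pq.
Qed.

Lemma open_baire2 (A : set (baire * baire)) :
  (forall p q, A (p, q) -> exists k, forall p' q', agree k p p' ->
     agree k q q' -> A (p', q')) -> open A.
Proof.
move=> h; rewrite openE => -[p q] /h[k hk].
exists ([set p' | agree k p p'], [set q' | agree k q q']).
  by split; apply/nbhs_baire; exists k.
by move=> -[p' q'] [/= ? ?]; exact: hk.
Qed.

Lemma open_baire3 (A : set (baire * (baire * baire))) :
  (forall p q r, A (p, (q, r)) -> exists k, forall p' q' r', agree k p p' ->
     agree k q q' -> agree k r r' -> A (p', (q', r'))) -> open A.
Proof.
move=> h; rewrite openE => -[p [q r]] /h[k hk].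
exists ([set p' | agree k p p'], [set q' | agree k q q'.1 /\ agree k r q'.2]).
  split=> /=; first by apply/nbhs_baire; exists k.
  exists ([set q' | agree k q q'], [set q' | agree k r q']) => //.
  by split; apply/nbhs_baire; exists k.
by move=> -[p' [q' r']] [/= ? [? ?]]; exact: hk.
Qed.

Lemma continuous_baire (g : baire -> baire) :
  (forall n, exists k, forall p q, agree k p q -> g p n = g q n) ->
  continuous g.
Proof.
move=> h p A /nbhs_baire[m mA]; apply/nbhs_baire.
have [|k hk] := uniform_bound _ h m.
  by move=> n j k jk hj p' q pq; apply: hj; exact: agree_le pq.
by exists k => q pq; apply: mA => i im; exact: hk.
Qed.

Definition tup (I : countType) (g : I -> baire) : baire :=
  fun m => if unpickle m is Some (i, n) then g i n else 0.

Definition prj (I : countType) (i : I) (p : baire) : baire :=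
  fun n => p (pickle (i, n)).

Lemma prj_tup (I : countType) (i : I) g : prj i (tup g) = g i.
Proof. by apply/funext => n; rewrite /prj /tup pickleK. Qed.

Lemma prj_agree (I : countType) (i : I) m :
  exists k, forall p q, agree k p q -> agree m (prj i p) (prj i q).
Proof.
have [||k hk] := @uniform_bound (fun n k => pickle (i, n) < k) _ _ m.
- by move=> n j k jk /leq_trans; apply.
- by move=> n; exists (pickle (i, n)).+1.
by exists k => p q pq n /hk /pq.
Qed.

Lemma prj_continuous (I : countType) (i : I) : continuous (prj i).
Proof.
apply: continuous_baire => n; have [k hk] := prj_agree i n.+1.
by exists k => p q /hk /(_ n); apply.
Qed.

Definition bcons n (p : baire) : baire := fun m => if m is m'.+1 then p m' else n.
Definition bhead (p : baire) : nat := p 0.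
Definition btail (p : baire) : baire := fun m => p m.+1.

Lemma agree_bcons n k p q : agree k p q -> agree k.+1 (bcons n p) (bcons n q).
Proof. by move=> pq [|i] //= /pq. Qed.

Lemma agree_btail k p q : agree k.+1 p q -> agree k (btail p) (btail q).
Proof. by move=> pq i ik; apply: pq. Qed.

Lemma btail_continuous : continuous btail.
Proof. by apply: continuous_baire => n; exists n.+2 => p q; apply. Qed.

(** ** Codes of open sets and of partial continuous functions *)

(* [acc e p]: the neighbourhood of [p] coded by some prefix of [p] is listed
   by [e]; thus [e] codes the open set [{p | acc e p}]. *)
Definition acc (e p : baire) : Prop := exists k, e (pickle (mkseq p k)) <> 0.

(* [appr e p r]: [r] is the result of applying the associate [e] to [p]. *)
Definition appr (e p r : baire) : Prop := forall n, exists k,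
  e (pickle (n, mkseq p k)) = (r n).+1 /\
  forall j, j < k -> e (pickle (n, mkseq p j)) = 0.

Lemma acc_open e p : acc e p ->
  exists k, forall e' p', agree k e e' -> agree k p p' -> acc e' p'.
Proof.
move=> [k ek]; exists (maxn (pickle (mkseq p k)).+1 k) => e' p'.
move=> /agree_max[ee' _] /agree_max[_ pp'].
by exists k; rewrite (agree_prefix pp') -ee'.
Qed.

Lemma appr_open (e p : baire) (n r : nat) : (exists k, e (pickle (n, mkseq p k)) = r.+1 /\
    forall j, j < k -> e (pickle (n, mkseq p j)) = 0) ->
  exists k, forall e' p', agree k e e' -> agree k p p' ->
    exists k, e' (pickle (n, mkseq p' k)) = r.+1 /\
    forall j, j < k -> e' (pickle (n, mkseq p' j)) = 0.
Proof.
move=> [k [ek e0]].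
have [||m hm] := @uniform_bound (fun j k => pickle (n, mkseq p j) < k) _ _ k.+1.
- by move=> i j l jk /leq_trans; apply.
- by move=> j; exists (pickle (n, mkseq p j)).+1.
exists (maxn m k) => e' p' /agree_max[ee' _] /agree_max[_ pp'].
exists k; split; first by rewrite (agree_prefix pp') -ee' // hm.
move=> j jk; rewrite (agree_prefix (agree_le (ltnW jk) pp')) -ee' ?e0 ?hm //.
exact: ltnW.
Qed.

Lemma first_unique (f : nat -> nat) j k x y :
  f j = x.+1 -> (forall i, i < j -> f i = 0) ->
  f k = y.+1 -> (forall i, i < k -> f i = 0) -> x = y.
Proof.
move=> fj j0 fk k0; have [jk|kj|jk] := ltngtP j k.
- by rewrite k0 in fj.
- by rewrite j0 in fk.
- by subst k; rewrite fj in fk; case: fk.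
Qed.

Lemma appr_fun e p r r' : appr e p r -> appr e p r' -> r = r'.
Proof.
move=> h h'; apply/funext => n; have [k [ek e0]] := h n.
have [k' [ek' e0']] := h' n.
exact: (first_unique (f := fun k => e (pickle (n, mkseq p k))) ek e0 ek' e0').
Qed.

Lemma appr_cont e p r m : appr e p r -> exists k, forall e' p' r',
  agree k e e' -> agree k p p' -> appr e' p' r' -> agree m r r'.
Proof.
move=> h; have [||k hk] := @uniform_bound (fun n k => forall e' p' r',
    agree k e e' -> agree k p p' -> appr e' p' r' -> r n = r' n) _ _ m.
- by move=> n j k jk hj e' p' r' ? ?; apply: hj; [exact: agree_le jk _|exact: agree_le jk _].
- move=> n; have [k hk] := appr_open (h n); exists k => e' p' r' ee pp h'.
  have [i [ei e0]] := hk _ _ ee pp; have [i' [ei' e0']] := h' n.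
  exact: (first_unique (f := fun k => e' (pickle (n, mkseq p' k))) ei e0 ei' e0').
by exists k => e' p' r' ee pp h' n nm; exact: hk n nm e' p' r' ee pp h'.
Qed.

Definition ucont (G : baire -> baire) : Prop :=
  forall n, exists k, forall t t', agree k t t' -> G t n = G t' n.

Lemma smn_acc (D V : baire -> baire -> Prop) :
  (forall t u, D t u -> V t u -> exists k, forall t' u', D t' u' ->
     agree k t t' -> agree k u u' -> V t' u') ->
  exists G, ucont G /\ forall t u, D t u -> (acc (G t) u <-> V t u).
Proof.
move=> oV; pose S t s := forall t' u', D t' u' -> agree (size s) t t' ->
  mkseq u' (size s) = s -> V t' u'.
pose G t m : nat := if unpickle m is Some s then `[< S t s >] else false.
exists G; split.
  move=> n; rewrite /G; case: (unpickle n) => [s|]; last by exists 0.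
  exists (size s) => t t' tt'; congr nat_of_bool; apply: asbool_equiv_eq.
  split=> h t'' u'' Dt tt''; apply: h => //; first exact: agree_trans tt' tt''.
  exact: agree_trans (agree_sym tt') tt''.
move=> t u Dtu; split.
  move=> [k]; rewrite /G pickleK; case: asboolP => // h _.
  by apply: h => //; rewrite size_mkseq.
move=> /(oV _ _ Dtu)[k hk]; exists k; rewrite /G pickleK; case: asboolP => //.
by case=> t' u' Dt; rewrite size_mkseq => tt' /agree_mkseq uu'; exact: hk.
Qed.

Lemma smn_app (D : baire -> baire -> Prop) (g : baire -> baire -> baire) :
  (forall t u, D t u -> forall n, exists k, forall t' u', D t' u' ->
     agree k t t' -> agree k u u' -> g t u n = g t' u' n) ->
  exists G, ucont G /\ forall t u, D t u -> appr (G t) u (g t u).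
Proof.
move=> cg; pose S t n s v := forall t' u', D t' u' -> agree (size s) t t' ->
  mkseq u' (size s) = s -> v = g t' u' n.
pose G t m : nat := if unpickle m is Some (n, s) then
  if `[< exists v, S t n s v >] then (xget 0 (S t n s)).+1 else 0 else 0.
exists G; split.
  move=> m; rewrite /G; case: (unpickle m) => [[n s]|]; last by exists 0.
  exists (size s) => t t' tt'; suff -> : S t n s = S t' n s by [].
  apply/seteqP.
  split=> v h t'' u'' Dt tt''; apply: h => //.
    exact: agree_trans tt' tt''.
  exact: agree_trans (agree_sym tt') tt''.
move=> t u Dtu n.
have ex : exists k, `[< exists v, S t n (mkseq u k) v >].
  have [k hk] := cg _ _ Dtu n; exists k; apply/asboolP; exists (g t u n).
  by move=> t' u' Dt; rewrite size_mkseq => tt' /agree_mkseq uu'; exact: hk.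
case: (ex_minnP ex) => k hk mink; exists k; split.
  rewrite /G pickleK hk; congr _.+1; move/asboolP: hk => /(xgetPex 0).
  by apply=> //; rewrite size_mkseq.
move=> j jk; rewrite /G pickleK; case: ifP => // /mink.
by rewrite leqNgt jk.
Qed.

(** * Represented spaces *)

Definition functional_rel (X : Type) (N : baire -> X -> Prop) :=
  forall p x y, N p x -> N p y -> x = y.

Definition dom (X : Type) (N : baire -> X -> Prop) p := exists x, N p x.

Definition gcont (D : baire -> Prop) (g : baire -> baire) :=
  forall t, D t -> forall n, exists k, forall t', D t' -> agree k t t' ->
    g t n = g t' n.

Definition ropen (X : Type) (N : baire -> X -> Prop) (U : set X) :=
  forall p x, N p x -> U x -> exists k, forall q y, agree k p q -> N q y -> U y.

Definition rcont (X : topologicalType) (N : baire -> X -> Prop) :=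
  forall U, open U -> ropen N U.

Definition EQr (X : Type) (N : baire -> X -> Prop) : set (baire * baire) :=
  [set pq | exists x, N pq.1 x /\ N pq.2 x].

(* A representation is treated as the relation "[p] is a name of [x]"; the
   topology is required to be the final one. *)
Record rep (X : topologicalType) (N : baire -> X -> Prop) : Prop := Rep {
  rep_fun : functional_rel N;
  rep_surj : forall x, exists p, N p x;
  rep_open : forall U, open U <-> ropen N U }.

Definition radm (X : topologicalType) (N : baire -> X -> Prop) : Prop :=
  forall M : baire -> X -> Prop, functional_rel M -> rcont M ->
  exists g, gcont (dom M) g /\ forall t x, M t x -> N (g t) x.

Lemma gcontP D g t m : gcont D g -> D t -> exists k, forall t', D t' ->
  agree k t t' -> agree m (g t) (g t').
Proof.
move=> cg Dt; have [|k hk] := uniform_bound _ (cg _ Dt) m.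
  by move=> n j k jk hj t' Dt' tt'; apply: hj => //; exact: agree_le tt'.
by exists k => t' Dt' tt' n nm; exact: hk.
Qed.

Lemma ucont_gcont G D : ucont G -> gcont D G.
Proof. by move=> cG t _ n; have [k hk] := cG n; exists k => t' _; exact: hk. Qed.

Lemma rep_rcont (X : topologicalType) (N : baire -> X -> Prop) : rep N -> rcont N.
Proof. by move=> rN U /(rep_open rN). Qed.

Definition rmap (X Y : Type) (f : X -> Y) (N : baire -> X -> Prop) p y :=
  exists2 x, N p x & f x = y.

Lemma rmap_fun (X Y : Type) (f : X -> Y) (N : baire -> X -> Prop) :
  functional_rel N -> functional_rel (rmap f N).
Proof. by move=> fN p y y' [x Nx <-] [x' Nx' <-]; rewrite (fN _ _ _ Nx Nx'). Qed.

Lemma rmap_rcont (X Y : topologicalType) (f : X -> Y) (N : baire -> X -> Prop) :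
  continuous f -> rcont N -> rcont (rmap f N).
Proof.
move=> /continuousP cf cN U /cf /cN oU p y [x Nx <-] Ux.
have [k hk] := oU _ _ Nx Ux; exists k => q z pq [w Nw <-]; exact: hk pq Nw.
Qed.

Lemma rep_continuous (X Y : topologicalType) (f : X -> Y) (N : baire -> X -> Prop) :
  rep N -> rcont (rmap f N) -> continuous f.
Proof.
move=> rN cf; apply/continuousP => U /cf oU; apply/(rep_open rN) => p x Nx Ux.
have [|k hk] := oU p (f x) _ Ux; first by exists x.
by exists k => q y pq Ny; apply: (hk q) => //; exists y.
Qed.

Lemma lift_rcont (X : topologicalType) (N M : baire -> X -> Prop) g :
  rcont N -> gcont (dom M) g -> (forall t x, M t x -> N (g t) x) -> rcont M.
Proof.
move=> cN cg gM U oU t x Mx Ux; have [k hk] := cN U oU _ _ (gM _ _ Mx) Ux.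
have [j hj] := @gcontP _ _ _ k cg (ex_intro _ x Mx).
exists j => t' x' tt' Mx'; apply: (hk (g t')); last exact: gM.
by apply: hj => //; exists x'.
Qed.

(* Suppose that membership [V] in the family [(U_b)] of subsets of [A] is
   open in names.  Then it is sequentially open, hence open, also along
   continuous maps [M] into [A] that need not lift to names: if it fails
   along sequences, the corresponding intersection of tails of [U_b], which
   is open by compactness of a convergent sequence with its limit, yields a
   contradiction. *)
Lemma evaluation_open (A : topologicalType) (B : Type) (N : baire -> A -> Prop)
    (NB : baire -> B -> Prop) (V : A -> B -> Prop) (M : baire -> A -> Prop) :
  rep N ->
  (forall a x b y, N a x -> NB b y -> V x y -> exists k, forall a' x' b' y',
     agree k a a' -> agree k b b' -> N a' x' -> NB b' y' -> V x' y') ->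
  rcont M ->
  forall t x b y, M t x -> NB b y -> V x y -> exists k, forall t' x' b' y',
    agree k t t' -> agree k b b' -> M t' x' -> NB b' y' -> V x' y'.
Proof.
move=> rN oV cM t x b y Mx By Vxy; apply: contrapT => nk.
have bad k : exists w : (baire * A) * (baire * B),
    [/\ agree k t w.1.1, agree k b w.2.1, M w.1.1 w.1.2, NB w.2.1 w.2.2 &
        ~ V w.1.2 w.2.2].
  apply: contrapT => nw; apply: nk; exists k => t' x' b' y' tt bb Mx' By'.
  by apply: contrapT => nV; apply: nw; exists ((t', x'), (b', y')).
have {bad}[w hw] := choice bad.
have [a Na] := rep_surj rN x.
have [m hm] := oV _ _ _ _ Na By Vxy.
pose O := [set x' | V x' y /\ forall n, m <= n -> V x' (w n).2.2].
have oO : open O.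
  apply/(rep_open rN) => a' x' Nx' [Vy Vn].
  have [k0 hk0] := oV _ _ _ _ Nx' By Vy.
  have [||k hk] := @uniform_bound (fun n k => m <= n -> forall a'' x'',
      agree k a' a'' -> N a'' x'' -> V x'' (w n).2.2) _ _ k0.
  - by move=> n i j ij h mn a'' x'' aa; apply: h => //; exact: agree_le aa.
  - move=> n; have [mn|] := leqP m n; last by exists 0.
    have [_ _ _ Bn _] := hw n; have [j hj] := oV _ _ _ _ Nx' Bn (Vn n mn).
    by exists j => _ a'' x'' aa N''; apply: hj aa _ N'' Bn.
  exists (maxn k0 k) => a'' x'' /agree_max[aa0 aa] N''; split.
    exact: hk0 aa0 _ N'' By.
  move=> n mn; have [nk0|k0n] := ltnP n k0; first exact: hk aa N''.
  have [_ bn _ Bn _] := hw n.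
  by apply: hk0 aa0 _ N'' Bn; exact: agree_le bn.
have Ox : O x.
  split=> // n mn; have [_ bn _ Bn _] := hw n.
  by apply: (hm a x _ _ _ _ Na Bn) => //; exact: agree_le bn.
have [j hj] := cM _ oO _ _ Mx Ox.
have [tn _ Mn _] := hw (maxn j m); apply.
have [_] := hj _ _ (agree_le (leq_maxl _ _) tn) Mn; apply.
exact: leq_maxr.
Qed.

(** * Qcb0-spaces *)

Lemma nbhs_sub (D : set baire) (d : D) (A : set D) :
  nbhs d A <-> exists k, forall d' : D, agree k (set_val d) (set_val d') -> A d'.
Proof.
split=> [[B [[U oU <-] Ud UA]]|[k hk]].
  have /nbhs_baire[k hk] : nbhs (set_val d) U by exact: open_nbhs_nbhs.
  by exists k => d' /hk h; exact: UA.
have : nbhs (set_val d) [set q | agree k (set_val d) q] by apply/nbhs_baire; exists k.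
rewrite nbhsE => -[U [oU Ud] UA]; exists (set_val @^-1` U); split=> //.
  by exists U.
by move=> d' /UA /hk.
Qed.

Lemma nbhs_forall_lt (Y : topologicalType) (y : Y) (P : nat -> set Y) k :
  (forall i, i < k -> nbhs y (P i)) -> nbhs y [set z | forall i, i < k -> P i z].
Proof.
elim: k => [|k IH] h; first exact: filterE.
have hk : nbhs y [set z | forall i, i < k -> P i z].
  by apply: IH => i ik; apply: h; exact: ltnW.
apply: filterS (filterI hk (h k (ltnSn k))) => z [h1 h2] i.
by rewrite ltnS leq_eqVlt => /orP[/eqP->|/h1].
Qed.

Lemma kolmogorov_open (X : topologicalType) : kolmogorov_space X <->
  forall x y : X, (forall U, open U -> (U x <-> U y)) -> x = y.
Proof.
split=> [h x y xy|h x y xy].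
  apply: contrapT => /eqP /h[A []] []; rewrite !inE /= nbhsE => -[U [oU Ux] UA].
    by apply; apply: UA; apply/(xy U oU).
  by apply; apply: UA; apply/(xy U oU).
apply: contrapT => nA; move/eqP: xy; apply; apply: h => U oU.
split=> h1; apply: contrapT => h2; apply: nA; exists U.
  by left; rewrite !inE; split=> //; exact: open_nbhs_nbhs.
by right; rewrite !inE; split=> //; exact: open_nbhs_nbhs.
Qed.

Lemma second_countable_sub (D : set baire) : @second_countable D.
Proof.
pose C (s : seq nat) := [set d : D | mkseq (set_val d) (size s) = s].
exists (range C).
  exact: sub_countable (card_image_le C setT) (countableP _).
split.
  move=> _ [s _ <-]; rewrite openE => d /= ds; apply/nbhs_sub.
  by exists (size s) => d' dd'; rewrite /C /= (agree_prefix dd').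
move=> d A /nbhs_sub[k hk]; exists (C (mkseq (set_val d) k)).
  by split; [exists (mkseq (set_val d) k)|rewrite /C /= size_mkseq].
by move=> d'; rewrite /C /= size_mkseq => h; apply: hk; apply/agree_mkseq.
Qed.

Lemma rep_of_second_countable (X Y : topologicalType) (q : Y -> X) :
  kolmogorov_space X -> @second_countable Y -> quotient_map q ->
  exists N : baire -> X -> Prop, rep N.
Proof.
move=> /kolmogorov_open T0 [B cB [oB bB]] [sq oq].
have [c injc] : exists c : set Y -> nat, {in B &, injective c}.
  by apply/countable_injP.
have {}injc U V : B U -> B V -> c U = c V -> U = V.
  by move=> BU BV; apply: injc; rewrite inE.
have base y (A : set Y) : nbhs y A -> exists U, [/\ B U, U y & U `<=` A].
  by move=> /bB [U [BU Uy] UA]; exists U.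
pose code (p : baire) y := (forall U, B U -> U y -> exists k, p k = (c U).+1) /\
  forall k n, p k = n.+1 -> exists U, [/\ B U, U y & c U = n].
have code_ex y k (p0 : baire) : (forall i n, i < k -> p0 i = n.+1 ->
    exists U, [/\ B U, U y & c U = n]) -> exists2 p, agree k p0 p & code p y.
  move=> h; pose p i := if i < k then p0 i else
    if `[< exists U, [/\ B U, U y & c U = i - k] >] then (i - k).+1 else 0.
  exists p; first by move=> i ik; rewrite /p ik.
  split=> [U BU Uy|i n].
    exists (c U + k); rewrite /p ltnNge leq_addl /= addnK.
    by case: asboolP => //; case; exists U.
  rewrite /p; case: ifP => ik; first exact: h.
  by case: asboolP => // ex [<-].
have code_sub p y U : open U -> code p y -> U (q y) -> exists k, forall p' y',
    agree k p p' -> code p' y' -> U (q y').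
  move=> /oq oU [py _] Uy.
  have [V [BV Vy VU]] := base y _ (open_nbhs_nbhs (conj oU Uy)).
  have [k pk] := py V BV Vy; exists k.+1 => p' y' pp' [_ /(_ k (c V))].
  by rewrite -pp' // => /(_ pk)[V' [BV' V'y' /(injc _ _ BV' BV) E]]; apply: VU; rewrite -E.
exists (fun p x => exists2 y, code p y & q y = x); split.
- move=> p x x' [y py <-] [y' py' <-]; apply: T0 => U oU.
  split=> Uy.
    by have [k hk] := code_sub _ _ _ oU py Uy; exact: hk py'.
  by have [k hk] := code_sub _ _ _ oU py' Uy; exact: hk py.
- move=> x; have [y <-] := sq x.
  by have [|p _ py] := @code_ex y 0 (fun=> 0) => //; exists p, y.
- move=> U; split=> [oU p x [y py <-] Uy|oU].
    have [k hk] := code_sub _ _ _ oU py Uy; exists k => p' x' pp' [y' py' <-].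
    exact: hk py'.
  apply/oq; rewrite openE => y Uy.
  have [|p _ py] := @code_ex y 0 (fun=> 0) => //.
  have [|k hk] := oU p (q y) _ Uy; first by exists y.
  have : nbhs y [set z | forall i, i < k -> forall n, p i = n.+1 ->
      exists U, [/\ B U, U z & c U = n]].
    apply: nbhs_forall_lt => i ik; have [_ /(_ i)] := py.
    case: (p i) => [_|m /(_ m erefl)[V [BV Vy cV]]]; first exact: filterE.
    apply: filterS (open_nbhs_nbhs (conj (oB _ BV) Vy)) => z Vz n [<-].
    by exists V.
  apply: filterS => z hz; have [|p' pp' p'z] := @code_ex z k p.
    by move=> i n ik; exact: hz.
  by apply: (hk p' (q z) pp'); exists z.
Qed.

Lemma rep_of_qcb0 (X : topologicalType) :
  qcb0 X -> exists N : baire -> X -> Prop, rep N.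
Proof. by move=> [T0 [Y [q [sY qY]]]]; exact: rep_of_second_countable sY qY. Qed.

Definition repr_space (G : pointclass) : space_class := fun X =>
  kolmogorov_space X /\
  exists N : baire -> X -> Prop, [/\ rep N, radm N & G _ (EQr N)].

Lemma repr_space_of (G : pointclass) (X : topologicalType) :
  qcb0_of G X -> repr_space G X.
Proof.
move=> [qX [D [delta [[sd cd ad] GE]]]]; split; first by case: qX.
pose N p x := exists2 d : D, set_val d = p & delta d = x.
have aN : radm N.
  move=> M fM cM; pose Z : set baire := dom M.
  have Zn (z : Z) : dom M (set_val z) by exact: set_valP.
  pose nu (z : Z) := projT1 (cid (Zn z)).
  have Mnu z : M (set_val z) (nu z) by exact: (projT2 (cid (Zn z))).
  have cnu : continuous nu.
    move=> z A; rewrite nbhsE => -[U [oU Uz] UA].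
    have [k hk] := cM _ oU _ _ (Mnu z) Uz.
    by apply/nbhs_sub; exists k => z' zz'; apply: UA; exact: hk zz' (Mnu z').
  have [g [cg gN]] := ad Z nu cnu.
  pose mk t (h : dom M t) : Z := exist _ t (mem_set h).
  have mkE t h : set_val (mk t h) = t by rewrite set_valE.
  exists (fun t => if pselect (dom M t) is left h then g (mk t h) else t).
  split=> [t Dt n|t x Mx].
    case: pselect => // h.
    have /nbhs_sub[k hk] : nbhs (mk t h) (g @^-1` [set r | agree n.+1 (g (mk t h)) r]).
      by apply: cg; apply/nbhs_baire; exists n.+1.
    exists k => t' Dt' tt'; case: pselect => // h'.
    by have := hk (mk t' h'); rewrite !mkE => /(_ tt' n); apply.
  case: pselect => [h|[]]; last by exists x.
  have [d [dg nud]] := gN (mk t h); exists d => //.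
  by rewrite -nud; apply: fM Mx; have := Mnu (mk t h); rewrite mkE.
have fN : functional_rel N.
  by move=> p x y [d <- <-] [d' /val_inj-> <-].
have sN x : exists p, N p x.
  by have [d dx] := sd x; exists (set_val d), d.
have cN : rcont N.
  move=> U oU p x [d <- <-] Ux.
  have /nbhs_sub[k hk] := cd d _ (open_nbhs_nbhs (conj oU Ux)).
  by exists k => q y h [d' dq <-]; apply: hk; rewrite dq.
exists N; split=> //; last first.
  rewrite (_ : EQr N = EQ delta) //; apply/seteqP; split=> -[p q] /=.
    by move=> [x [[d dp dx] [d' dq d'x]]]; exists d, d'; split=> //; rewrite dx.
  by move=> [d [d' [dp dq dd]]]; exists (delta d); split; [exists d|exists d'].
split=> // U; split=> [oU|oU]; first exact: cN.
have [N0 rN0] := rep_of_qcb0 qX.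
have [g [cg gN]] := aN _ (rep_fun rN0) (rep_rcont rN0).
apply/(rep_open rN0) => p x Nx Ux; have [k hk] := oU _ _ (gN _ _ Nx) Ux.
have [j hj] := @gcontP _ _ _ k cg (ex_intro _ x Nx).
exists j => p' x' pp' Nx'; apply: (hk (g p')); last exact: gN.
by apply: hj => //; exists x'.
Qed.

Lemma of_repr_space (G : pointclass) (X : topologicalType) :
  repr_space G X -> qcb0_of G X.
Proof.
move=> [T0 [N [rN aN GE]]]; pose D : set baire := dom N.
have Dn (d : D) : dom N (set_val d) by exact: set_valP.
pose delta (d : D) := projT1 (cid (Dn d)).
have Nd d : N (set_val d) (delta d) by exact: (projT2 (cid (Dn d))).
have Dex p x : N p x -> exists d : D, set_val d = p /\ delta d = x.
  move=> Nx; have h : D p by exists x.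
  exists (exist _ p (mem_set h)); rewrite set_valE; split=> //.
  by apply: (rep_fun rN) Nx; have := Nd (exist _ p (mem_set h)); rewrite set_valE.
have cd : continuous delta.
  move=> d A; rewrite nbhsE => -[U [oU Ud] UA].
  have [k hk] := rep_rcont rN oU (Nd d) Ud.
  by apply/nbhs_sub; exists k => d' dd'; apply: UA; exact: hk dd' (Nd d').
have sd : representation delta.
  by move=> x; have [p /Dex[d [_ dx]]] := rep_surj rN x; exists d.
split.
  split=> //; exists D, delta; split; first exact: second_countable_sub.
  split=> // U; split=> [oU|oU]; first by move/continuousP: cd; apply.
  apply/(rep_open rN) => p x /Dex[d [<- <-]] Ud.
  have /nbhs_sub[k hk] := open_nbhs_nbhs (conj oU (Ud : (delta @^-1` U) d)).
  by exists k => q y dq /Dex[d' [dd' <-]]; apply: hk; rewrite dd'.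
exists D, delta; split; last first.
  rewrite (_ : EQ delta = EQr N) //; apply/seteqP; split=> -[p q] /=.
    move=> [d [d' [/= dp dq dd]]]; exists (delta d) => /=.
    by split; [rewrite -dp|rewrite -dq dd]; exact: Nd.
  move=> [x [/Dex[d [dp dx]] /Dex[d' [dq dx']]]].
  by exists d, d'; split=> //; rewrite dx.
split=> // Z nu cnu; pose M p x := exists2 z : Z, set_val z = p & nu z = x.
have fM : functional_rel M.
  by move=> p x y [d <- <-] [d' /val_inj-> <-].
have cM : rcont M.
  move=> U oU p x [d <- <-] Ux.
  have /nbhs_sub[k hk] := cnu d _ (open_nbhs_nbhs (conj oU Ux)).
  by exists k => q y h [d' dq <-]; apply: hk; rewrite dq.
have [g [cg gN]] := aN _ fM cM.
exists (fun z => g (set_val z)); split.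
  move=> z A /nbhs_baire[m hm]; apply/nbhs_sub.
  have domM (z' : Z) : dom M (set_val z') by exists (nu z'), z'.
  have [k hk] := @gcontP _ _ _ m cg (domM z).
  by exists k => z' zz'; apply: hm; apply: hk.
move=> z; have /Dex[d [dg dx]] : N (g (set_val z)) (nu z) by apply: gN; exists z.
by exists d; rewrite dg dx.
Qed.

Lemma qcb0_of_hyperprojective (X : topologicalType) :
  qcb0_hp X <-> repr_space hyperprojective X.
Proof.
split=> [[W [a [qX [D [delta [ad S]]]]]]|/of_repr_space [qX [D [delta [ad [W [a S]]]]]]].
  by apply: repr_space_of; split=> //; exists D, delta; split=> //; exists W, a.
by exists W, a; split=> //; exists D, delta.
Qed.

(** * Definability in a closed pointclass *)

Lemma fst_comp_continuous (X Y Z : topologicalType) (f : X -> (Y * Z)%type) :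
  continuous f -> continuous (fun x => (f x).1).
Proof.
by move=> cf x; apply: (@continuous_comp _ _ _ f fst); [exact: cf|exact: cvg_fst].
Qed.

Lemma snd_comp_continuous (X Y Z : topologicalType) (f : X -> (Y * Z)%type) :
  continuous f -> continuous (fun x => (f x).2).
Proof.
by move=> cf x; apply: (@continuous_comp _ _ _ f snd); [exact: cf|exact: cvg_snd].
Qed.

Lemma pair_continuous (X Y Z : topologicalType) (f : X -> Y) (g : X -> Z) :
  continuous f -> continuous g -> continuous (fun x => (f x, g x)).
Proof. by move=> cf cg x; apply: cvg_pair; [exact: cf|exact: cg]. Qed.

Lemma prj_comp_continuous (X : topologicalType) (I : countType) (i : I)
    (f : X -> baire) : continuous f -> continuous (fun x => prj i (f x)).
Proof.
move=> cf x; apply: (@continuous_comp _ _ _ f (prj i)); first exact: cf.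
exact: prj_continuous.
Qed.

Lemma btail_comp_continuous (X : topologicalType) (f : X -> baire) :
  continuous f -> continuous (fun x => btail (f x)).
Proof.
move=> cf x; apply: (@continuous_comp _ _ _ f btail); first exact: cf.
exact: btail_continuous.
Qed.

Ltac prove_continuous := repeat first
  [ assumption
  | exact: cst_continuous
  | exact: idfun_continuous
  | exact: btail_continuous
  | apply: prj_comp_continuous
  | apply: btail_comp_continuous
  | apply: pair_continuous
  | apply: fst_comp_continuous
  | apply: snd_comp_continuous ].

Section Definability.
Variables (G : pointclass) (clG : closed_pointclass G).

Definition definable (X : topologicalType) (P : X -> Prop) := G [set x | P x].

Section Connectives.
Variable X : topologicalType.
Implicit Types P Q : X -> Prop.

Lemma definable_eq P Q : (forall x, P x <-> Q x) -> definable P -> definable Q.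
Proof.
by move=> PQ; rewrite /definable (_ : mkset P = mkset Q) //; apply/seteqP; split=> x /PQ.
Qed.

Lemma definable_not P : definable P -> definable (fun x => ~ P x).
Proof. exact: pcl_compl. Qed.

Lemma definable_forall (I : countType) (P : I -> X -> Prop) :
  (forall i, definable (P i)) -> definable (fun x => forall i, P i x).
Proof.
move=> h; rewrite /definable.
pose A n := if unpickle n is Some i then [set x | P i x] else setT.
rewrite (_ : mkset _ = \bigcap_n A n).
  apply: (pcl_bigcap clG) => n; rewrite /A; case: (unpickle n) => [i|]; first exact: h.
  by apply: (pcl_open clG); exact: openT.
apply/seteqP; split=> x /= hx.
  by move=> n _; rewrite /A; case: (unpickle n) => [i|].
by move=> i; have := hx (pickle i) Logic.I; rewrite /A pickleK.
Qed.

Lemma definable_exists (I : countType) (P : I -> X -> Prop) :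
  (forall i, definable (P i)) -> definable (fun x => exists i, P i x).
Proof.
move=> h; apply: (@definable_eq (fun x => ~ forall i, ~ P i x)).
  by move=> x; split=> [/existsNP[i /contrapT]|[i Pi] /(_ i)]; first by exists i.
by apply: definable_not; apply: definable_forall => i; exact: definable_not.
Qed.

Lemma definable_and P Q : definable P -> definable Q ->
  definable (fun x => P x /\ Q x).
Proof.
move=> hP hQ; apply: (@definable_eq (fun x => forall b : bool, (if b then P else Q) x)).
  by move=> x; split=> [h|[? ?] []] //; split; [exact: (h true)|exact: (h false)].
by apply: definable_forall => -[].
Qed.

Lemma definable_or P Q : definable P -> definable Q ->
  definable (fun x => P x \/ Q x).
Proof.
move=> hP hQ; apply: (@definable_eq (fun x => exists b : bool, (if b then P else Q) x)).
  by move=> x; split=> [[[]]|[]] ?; [left|right|exists true|exists false].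
by apply: definable_exists => -[].
Qed.

Lemma definable_imp P Q : definable P -> definable Q ->
  definable (fun x => P x -> Q x).
Proof.
move=> hP hQ; apply: (@definable_eq (fun x => ~ P x \/ Q x)).
  move=> x; split=> [[]//|h]; have [/h|] := pselect (P x); first by right.
  by left.
by apply: definable_or => //; exact: definable_not.
Qed.

Lemma definable_iff P Q : definable P -> definable Q ->
  definable (fun x => P x <-> Q x).
Proof. by move=> hP hQ; apply: definable_and; exact: definable_imp. Qed.

Lemma definable_ex (P : baire -> X -> Prop) :
  definable (fun px : baire * X => P px.1 px.2) ->
  definable (fun x => exists p, P p x).
Proof. exact: (pcl_exists clG). Qed.

Lemma definable_all (P : baire -> X -> Prop) :
  definable (fun px : baire * X => P px.1 px.2) ->
  definable (fun x => forall p, P p x).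
Proof.
move=> h; apply: (@definable_eq (fun x => ~ exists p, ~ P p x)).
  by move=> x; split=> [h1 p|h1 [p]] //; apply: contrapT => h2; apply: h1; exists p.
by apply: definable_not; apply: definable_ex; exact: (pcl_compl clG h).
Qed.

Lemma definable_mem (Y : topologicalType) (A : set Y) (f : X -> Y) :
  G A -> continuous f -> definable (fun x => A (f x)).
Proof. by move=> GA cf; exact: (pcl_preimage clG cf GA). Qed.

Lemma definable_acc (a b : X -> baire) : continuous a -> continuous b ->
  definable (fun x => acc (a x) (b x)).
Proof.
move=> ca cb.
apply: (@definable_mem _ [set pq : baire * baire | acc pq.1 pq.2] (fun x => (a x, b x))).
  by apply: (pcl_open clG); apply: open_baire2 => p q; exact: acc_open.
exact: pair_continuous.
Qed.

Lemma definable_appr (a b c : X -> baire) :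
  continuous a -> continuous b -> continuous c ->
  definable (fun x => appr (a x) (b x) (c x)).
Proof.
move=> ca cb cc; apply: definable_forall => n.
pose A := [set w : baire * (baire * baire) |
  exists k, w.1 (pickle (n, mkseq w.2.1 k)) = (w.2.2 n).+1 /\
    forall j, j < k -> w.1 (pickle (n, mkseq w.2.1 j)) = 0].
apply: (@definable_mem _ A (fun x => (a x, (b x, c x)))).
  apply: (pcl_open clG); apply: open_baire3 => e p r /appr_open[k hk].
  exists (maxn k n.+1) => e' p' r' /agree_max[ee _] /agree_max[pp _] /agree_max[_ rr].
  by have := hk _ _ ee pp; rewrite /A /= rr.
by do !apply: pair_continuous.
Qed.

Lemma definable_EQ (E : set (baire * baire)) (a b : X -> baire) :
  G E -> continuous a -> continuous b -> definable (fun x => E (a x, b x)).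
Proof. by move=> GE ca cb; apply: definable_mem => //; exact: pair_continuous. Qed.

Lemma definable_head (a : X -> baire) (n : nat) : continuous a ->
  definable (fun x => bhead (a x) = n).
Proof.
move=> ca; apply: (@definable_mem _ [set p : baire | p 0 = n] a) => //.
apply: (pcl_open clG); rewrite openE => p /= <-; apply/nbhs_baire; exists 1 => q.
by move=> h; rewrite /= /bhead -h.
Qed.

End Connectives.

End Definability.

Ltac prove_definable clG := repeat first
  [ assumption
  | apply: (definable_and clG)
  | apply: (definable_or clG)
  | apply: (definable_iff clG)
  | apply: (definable_ex clG)
  | apply: (definable_all clG)
  | apply: (definable_imp clG)
  | (apply: (definable_acc clG); solve [prove_continuous])
  | (apply: (definable_appr clG); solve [prove_continuous])
  | (apply: (definable_head clG); solve [prove_continuous])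
  | (apply: (definable_EQ clG); [assumption|solve [prove_continuous]|solve [prove_continuous]]) ].

Lemma closed_everything : closed_pointclass (fun _ _ => True).
Proof. by []. Qed.

(** * Final topologies and Kolmogorov quotients *)

Definition final_space (X : Type) (N : baire -> X -> Prop) : Type := X.

Section FinalTopology.
Variables (X : Type) (N : baire -> X -> Prop).

HB.instance Definition _ := gen_eqMixin (final_space N).
HB.instance Definition _ := gen_choiceMixin (final_space N).

Let fopen : set_system (final_space N) := [set U | ropen N U].

Let fopenT : fopen setT.
Proof. by move=> p x _ _; exists 0. Qed.

Let fopenI : setI_closed fopen.
Proof.
move=> U V oU oV p x Nx [Ux Vx]; have [j hj] := oU _ _ Nx Ux.
have [k hk] := oV _ _ Nx Vx; exists (maxn j k) => q y /agree_max[jq kq] Ny.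
by split; [exact: hj jq Ny|exact: hk kq Ny].
Qed.

Let fopenU : forall (I : Type) (f : I -> set (final_space N)),
  (forall i, fopen (f i)) -> fopen (\bigcup_i f i).
Proof.
move=> I f of_ p x Nx [i _ fx]; have [k hk] := of_ i _ _ Nx fx.
by exists k => q y pq Ny; exists i => //; exact: hk pq Ny.
Qed.

HB.instance Definition _ :=
  isOpenTopological.Build (final_space N) fopenT fopenI fopenU.

Lemma final_rep : functional_rel N -> (forall x, exists p, N p x) ->
  @rep (final_space N) N.
Proof. by move=> fN sN; split. Qed.

End FinalTopology.

Lemma rep_transport (X Y : topologicalType) (N : baire -> X -> Prop)
    (f : X -> Y) (g : Y -> X) :
  rep N -> continuous f -> continuous g -> cancel f g -> cancel g f ->
  rep (fun p y => N p (g y)).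
Proof.
move=> rN cf cg fg gf; split.
- by move=> p x y Nx Ny; rewrite -[x]gf -[y]gf (rep_fun rN Nx Ny).
- by move=> y; have [p Np] := rep_surj rN (g y); exists p.
- move=> U; split=> [oU p y Ny Uy|oU].
    have /(rep_open rN) oV : open (f @^-1` U) by move/continuousP: cf; apply.
    have [|k hk] := oV _ _ Ny; first by rewrite /preimage /= gf.
    by exists k => q z pq Nz; have := hk _ _ pq Nz; rewrite /preimage /= gf.
  rewrite (_ : U = g @^-1` (f @^-1` U)); last by rewrite -comp_preimage (_ : f \o g = id) //; apply/funext.
  move/continuousP: cg; apply; apply/(rep_open rN) => p x Nx Ux.
  have [|k hk] := oU p (f x) _ Ux; first by rewrite fg.
  by exists k => q y pq Ny; apply: (hk q (f y) pq); rewrite fg.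
Qed.

Lemma repr_space_homeo (G : pointclass) (X Y : topologicalType)
    (f : X -> Y) (g : Y -> X) :
  continuous f -> continuous g -> cancel f g -> cancel g f ->
  repr_space G X -> repr_space G Y.
Proof.
move=> cf cg fg gf [/kolmogorov_open T0 [N [rN aN GN]]]; split.
  apply/kolmogorov_open => x y xy; rewrite -[x]gf -[y]gf; congr f; apply: T0 => U oU.
  have oV : open (g @^-1` U) by move/continuousP: cg; apply.
  exact: (xy _ oV).
exists (fun p y => N p (g y)); split; first exact: rep_transport rN cf cg fg gf.
  move=> M fM cM.
  have [h [ch hN]] := aN (rmap g M) (rmap_fun fM) (rmap_rcont cg cM).
  exists h; split; last by move=> t y My; apply: hN; exists y.
  move=> t [y My] n; have [|k hk] := ch t _ n; first by exists (g y), y.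
  by exists k => t' [y' My'] tt'; apply: hk => //; exists (g y'), y'.
rewrite (_ : EQr _ = EQr N) //; apply/seteqP; split=> -[p q] [x [h1 h2]] /=.
  by exists (g x).
by exists (f x); rewrite fg.
Qed.

(* The admissible representation: [r] names [x] when it accepts exactly those
   codes of open sets whose open set contains [x], i.e. names of the
   neighbourhood filter of [x] in the double dual. *)
Lemma rep_admissible (G : pointclass) (X : topologicalType)
    (N : baire -> X -> Prop) :
  closed_pointclass G -> kolmogorov_space X -> rep N -> G _ (EQr N) ->
  repr_space G X.
Proof.
move=> clG T0 rN GN; split=> //; move/kolmogorov_open: T0 => T0.
pose sat p := forall u v, EQr N (u, v) -> (acc p u <-> acc p v).
pose named r u := forall p, sat p -> (acc r p <-> acc p u).
have code U : open U -> exists2 p, sat p & forall u x, N u x -> (acc p u <-> U x).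
  move=> /(rep_open rN) oU.
  have [|P [_ hP]] := @smn_acc (fun t u => dom N u) (fun t u => exists2 x, N u x & U x).
    move=> t u _ [x Nx Ux]; have [k hk] := oU _ _ Nx Ux.
    by exists k => t' u' [x' Nx'] _ uu'; exists x' => //; exact: hk uu' Nx'.
  have hp u x : N u x -> (acc (P point) u <-> U x).
    move=> Nx; rewrite hP; last by exists x.
    split=> [[y Ny]|Ux]; first by rewrite (rep_fun rN Nx Ny).
    by exists x.
  by exists (P point) => // u v [x [/= Nu Nv]]; rewrite (hp _ _ Nu) (hp _ _ Nv).
pose N' r x := exists2 u, N u x & named r u.
have codeP r x U p : N' r x -> sat p -> (forall u x, N u x -> (acc p u <-> U x)) ->
    (acc r p <-> U x).
  by move=> [u Nu ru] sp hp; rewrite (ru p sp); exact: hp.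
have fN' : functional_rel N'.
  move=> r x y rx ry; apply: T0 => U oU; have [p sp hp] := code U oU.
  by rewrite -(codeP _ _ _ _ rx sp hp) -(codeP _ _ _ _ ry sp hp).
have cN' : rcont N'.
  move=> U oU r x rx Ux; have [p sp hp] := code U oU.
  have /acc_open[k hk] : acc r p by apply/(codeP _ _ _ _ rx sp hp).
  by exists k => r' x' rr' rx'; rewrite -(codeP _ _ _ _ rx' sp hp); exact: hk.
have aN' : radm N'.
  move=> M fM cM; pose B p (p' : baire) := p = p' /\ sat p.
  pose V x p := exists2 u, N u x & acc p u.
  have VE u x p : N u x -> sat p -> (V x p <-> acc p u).
    move=> Nu sp; split=> [[v Nv pv]|pu]; last by exists u.
    by apply/(sp v u) => //; exists x.
  have oV : forall t x b y, M t x -> B b y -> V x y -> exists k, forall t' x' b' y',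
      agree k t t' -> agree k b b' -> M t' x' -> B b' y' -> V x' y'.
    apply: (evaluation_open rN _ cM) => a x b y Na [<- sb] /(VE _ _ _ Na sb).
    move=> /acc_open[k hk]; exists k => a' x' b' y' aa bb Na' [<- sb'].
    by apply/(VE _ _ _ Na' sb'); exact: hk.
  have [|g [cg hg]] := @smn_acc (fun t p => dom M t /\ sat p)
      (fun t p => exists2 x, M t x & V x p).
    move=> t p [_ sp] [x Mx Vx].
    have [k hk] := oV t x p p Mx (conj erefl sp) Vx.
    exists k => t' p' [[x' Mx'] sp'] tt' pp'; exists x' => //.
    exact: hk tt' pp' Mx' (conj erefl sp').
  exists g; split; first exact: ucont_gcont.
  move=> t x Mx; have [u Nu] := rep_surj rN x; exists u => // p sp.
  rewrite hg; last by split=> //; exists x.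
  rewrite -(VE _ _ _ Nu sp); split=> [[y My]|Vx]; last by exists x.
  by rewrite (fM _ _ _ Mx My).
exists N'; split=> //.
  have [g [cg hg]] := aN' _ (rep_fun rN) (rep_rcont rN); split=> //.
    by move=> x; have [u /hg Nu] := rep_surj rN x; exists (g u).
  move=> U; split=> [oU|oU]; first exact: cN'.
  apply/(rep_open rN) => u x Nu Ux; have [k hk] := oU _ _ (hg _ _ Nu) Ux.
  have [j hj] := @gcontP _ _ _ k cg (ex_intro _ x Nu).
  exists j => v y uv Nv; apply: (hk (g v)); last exact: hg.
  by apply: hj => //; exists y.
suff : definable G (fun pq : baire * baire => exists u, EQr N (u, u) /\
    ((forall p, (forall v w, EQr N (v, w) -> (acc p v <-> acc p w)) ->
       (acc pq.1 p <-> acc p u)) /\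
     (forall p, (forall v w, EQr N (v, w) -> (acc p v <-> acc p w)) ->
       (acc pq.2 p <-> acc p u)))).
  apply: definable_eq => -[r r'] /=; split.
    by move=> [u [[x [Nu _]] [ru ru']]]; exists x; split; exists u.
  move=> [x [[u /= Nu ru] [v Nv rv]]]; exists u; split; first by exists x.
  split=> // p sp; rewrite (rv p sp); apply: (sp v u).
  by exists x.
prove_definable clG.
Qed.

(* The [T0]-quotient, in qcb0-spaces, of the subspace [D] by the relation [R]:
   two points are identified when no [R]-saturated open subset of [D]
   separates them. *)
Lemma kolmogorov_quotient (G : pointclass) (D : set baire) (R : set (baire * baire)) :
  closed_pointclass G -> G _ D -> G _ R ->
  (forall u v, R (u, v) -> D u /\ D v) ->
  exists (Q : topologicalType) (N : baire -> Q -> Prop),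
    [/\ repr_space G Q, rep N, forall u, D u <-> dom N u,
        forall u v x y, N u x -> N v y -> R (u, v) -> x = y &
        forall (Z : topologicalType) (M : baire -> Z -> Prop),
          kolmogorov_space Z -> rcont M -> (forall u, dom M u <-> D u) ->
          functional_rel M ->
          (forall u v x y, M u x -> M v y -> R (u, v) -> x = y) ->
          exists h : Q -> Z, continuous h /\
            forall u x y, N u x -> M u y -> h x = y].
Proof.
move=> clG GD GR RD.
pose sat p := forall u v, R (u, v) -> (acc p u <-> acc p v).
pose eqv u v := [/\ D u, D v & forall p, sat p -> (acc p u <-> acc p v)].
pose T := {A : set baire | exists2 u, D u & A = eqv u}.
pose N u (x : T) := D u /\ sval x = eqv u.
have eqvE u v : D u -> D v -> (forall p, sat p -> (acc p u <-> acc p v)) -> eqv u = eqv v.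
  move=> Du Dv uv; apply/seteqP; split=> w [_ Dw h]; split=> // p sp.
    by rewrite -(uv p sp); exact: h.
  by rewrite (uv p sp); exact: h.
have Nex u : D u -> exists x, N u x.
  move=> Du; have h : exists2 v, D v & eqv u = eqv v by exists u.
  by exists (exist _ (eqv u) h).
have NE u v x : N u x -> N v x -> eqv u v.
  by move=> [Du Eu] [Dv Ev]; rewrite -Eu Ev.
have fN : functional_rel N.
  move=> u [A hA] [B hB] [_ /= E] [_ /= E'].
  by apply: eq_exist; rewrite E E'.
have sN x : exists u, N u x by case: x => A [u Du AE]; exists u.
have rN := final_rep fN sN.
have eqvN u v x y : N u x -> N v y -> (forall p, sat p -> (acc p u <-> acc p v)) -> x = y.
  move=> Nu Nv h; apply: (fN v) => //; case: Nu Nv => Du xE [Dv _].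
  by split=> //; rewrite xE; exact: eqvE.
have RN u v x y : N u x -> N v y -> R (u, v) -> x = y.
  by move=> Nu Nv Ruv; apply: (eqvN _ _ _ _ Nu Nv) => p sp; exact: sp.
have T0 : kolmogorov_space (final_space N).
  apply/kolmogorov_open => x y xy; have [u Nu] := sN x; have [v Nv] := sN y.
  apply: (eqvN _ _ _ _ Nu Nv) => p sp.
  pose U := [set z | exists2 w, N w z & acc p w].
  have UE w z : N w z -> (U z <-> acc p w).
    move=> Nw; split=> [[w' Nw' pw']|pw]; last by exists w.
    by have [_ _ /(_ p sp)] := NE _ _ _ Nw Nw' => ->.
  rewrite -(UE _ _ Nu) -(UE _ _ Nv); apply: xy.
  apply/(rep_open rN) => w z Nw /(UE _ _ Nw)/acc_open[k hk].
  by exists k => w' z' ww' Nw'; apply/(UE _ _ Nw'); exact: hk.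
exists (final_space N), N; split=> //.
- apply: (rep_admissible clG T0 rN).
  suff : definable G (fun uv : baire * baire => (D uv.1 /\ D uv.2) /\ forall p,
      (forall u v, R (u, v) -> (acc p u <-> acc p v)) -> (acc p uv.1 <-> acc p uv.2)).
    apply: definable_eq => -[u v] /=; split.
      move=> [[Du Dv] h]; have [x Nx] := Nex u Du; exists x; split=> //=.
      have [y Ny] := Nex v Dv.
      by rewrite (eqvN _ _ _ _ Nx Ny h).
    by move=> [x [/= Nu Nv]]; have [? ? h] := NE _ _ _ Nu Nv.
  apply: (definable_and clG); last by prove_definable clG.
  by apply: (definable_and clG);
    apply: (definable_mem clG) => //; prove_continuous.
- by move=> u; split=> [/Nex|[x []]].
move=> Z M /kolmogorov_open T0Z cM dM fM RM.
have hM u v x y y' : N u x -> N v x -> M u y -> M v y' -> y = y'.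
  move=> Nu Nv Mu Mv; apply: T0Z => U oU.
  have [|P [_ hP]] := @smn_acc (fun t u => D u) (fun t u => exists2 x, M u x & U x).
    move=> t w _ [z Mz Uz]; have [k hk] := cM _ oU _ _ Mz Uz.
    exists k => t' w' /dM[z' Mz'] _ ww'; exists z' => //; exact: hk ww' Mz'.
  have hp w z : M w z -> (acc (P point) w <-> U z).
    move=> Mw; rewrite hP; last by apply/dM; exists z.
    split=> [[z' Mz']|Uz]; first by rewrite (fM _ _ _ Mw Mz').
    by exists z.
  have [_ _ /(_ (P point))] := NE _ _ _ Nu Nv.
  rewrite (hp _ _ Mu) (hp _ _ Mv); apply=> w w' Rww.
  have [/dM[z Mz] /dM[z' Mz']] := RD _ _ Rww.
  by rewrite (hp _ _ Mz) (hp _ _ Mz') (RM _ _ _ _ Mz Mz' Rww).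
have ex (x : T) : exists z, exists2 u, N u x & M u z.
  have [u Nu] := sN x; have [z Mz] : dom M u by apply/dM; case: Nu.
  by exists z, u.
have [h hh] := choice ex; exists h.
have hE u x y : N u x -> M u y -> h x = y.
  by move=> Nu Mu; have [v Nv Mv] := hh x; exact: hM Nv Nu Mv Mu.
split=> //; apply: (rep_continuous rN) => U oU u z [x Nx <-] Uz.
have [y My] : dom M u by apply/dM; case: Nx.
have [|k hk] := cM U oU _ _ My; first by rewrite -(hE _ _ _ Nx My).
exists k => u' z' uu' [x' Nx' <-].
have [y' My'] : dom M u' by apply/dM; case: Nx'.
by rewrite (hE _ _ _ Nx' My'); exact: hk uu' My'.
Qed.

Lemma repr_space_qcb0 (G : pointclass) (X : topologicalType) :
  repr_space G X -> qcb0 X.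
Proof. by case/of_repr_space. Qed.

Lemma qcb0_repr_space (X : topologicalType) :
  qcb0 X <-> repr_space (fun _ _ => True) X.
Proof.
split=> [qX|/repr_space_qcb0//]; have [N rN] := rep_of_qcb0 qX.
by apply: (rep_admissible closed_everything _ rN) => //; case: qX.
Qed.

Lemma qcb0_hp_qcb0 (X : topologicalType) : qcb0_hp X -> qcb0 X.
Proof. by move/qcb0_of_hyperprojective/repr_space_qcb0. Qed.

Lemma rcont_sub (X : topologicalType) (M M' : baire -> X -> Prop) :
  (forall t x, M t x -> M' t x) -> rcont M' -> rcont M.
Proof.
move=> MM cM U oU t x Mx Ux; have [k hk] := cM U oU _ _ (MM _ _ Mx) Ux.
by exists k => t' x' tt' /MM; exact: hk.
Qed.

Lemma realizer (X Y : topologicalType) (N : baire -> X -> Prop)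
    (NY : baire -> Y -> Prop) (f : X -> Y) :
  rep N -> radm NY -> continuous f ->
  exists e, forall p x, N p x -> exists2 r, appr e p r & NY r (f x).
Proof.
move=> rN aY cf.
have [F [cF hF]] := aY _ (rmap_fun (rep_fun rN)) (rmap_rcont cf (rep_rcont rN)).
have [|G [_ hG]] := @smn_app (fun t p => dom N p) (fun t p => F p).
  move=> t p [x Nx] n; have [|k hk] := cF p _ n; first by exists (f x), x.
  by exists k => t' p' [x' Nx'] _ pp; apply: hk => //; exists (f x'), x'.
exists (G point) => p x Nx; exists (F p); first by apply: hG; exists x.
by apply: hF; exists x.
Qed.

Lemma realized_rcont (T X Y : topologicalType) (M : baire -> T -> Prop)
    (NY : baire -> Y -> Prop) (f : T -> Y) (a b : baire -> baire) :
  rcont NY -> gcont (dom M) a -> gcont (dom M) b ->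
  (forall t x, M t x -> exists2 r, appr (a t) (b t) r & NY r (f x)) ->
  rcont (rmap f M).
Proof.
move=> cY ca cb hf U oU t y [x Mx <-] Ux.
have [r rr Nr] := hf _ _ Mx; have [m hm] := cY _ oU _ _ Nr Ux.
have [j hj] := appr_cont m rr; have dt : dom M t by exists x.
have [k hk] := gcontP j ca dt; have [l hl] := gcontP j cb dt.
exists (maxn k l) => t' y' /agree_max[tk tl] [x' Mx' <-].
have [r' rr' Nr'] := hf _ _ Mx'; have dt' : dom M t' by exists x'.
by apply: (hm r') => //; apply: hj rr'; [exact: hk|exact: hl].
Qed.

(** * Countable limits *)

Section QuiverLimit.
Variables (I K : countType) (X : I -> topologicalType) (s t : K -> I).
Variable phi : forall k, X (s k) -> X (t k).

Record quiver_limit (L : topologicalType) (p : forall i, L -> X i) : Prop :=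
  QuiverLimit {
  ql_cont : forall i, continuous (p i);
  ql_cone : forall k l, phi (p (s k) l) = p (t k) l;
  ql_ex : forall x : forall i, X i, (forall k, phi (x (s k)) = x (t k)) ->
    exists l, forall i, p i l = x i;
  ql_inj : forall l l', (forall i, p i l = p i l') -> l = l';
  ql_rcont : forall M : baire -> L -> Prop, functional_rel M ->
    (forall i, rcont (rmap (p i) M)) -> rcont M }.

Arguments ql_cont {L p} _ i.

Lemma quiver_limit_universal (L Z : topologicalType) (p : forall i, L -> X i)
    (f : forall i, Z -> X i) :
  quiver_limit p -> qcb0 Z -> (forall i, continuous (f i)) ->
  (forall k, @phi k \o f (s k) = f (t k)) ->
  exists! h : Z -> L, continuous h /\ forall i, p i \o h = f i.
Proof.
move=> lp /rep_of_qcb0[N rN] cf ff.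
have /choice[h hf] : forall z, exists l, forall i, p i l = f i z.
  move=> z; apply: (ql_ex lp) => k.
  by rewrite -(congr1 (fun g => g z) (ff k)).
exists h; split=> [|h' [_ hf']].
  split=> [|i]; last by apply/funext => z; exact: hf.
  apply: (rep_continuous rN); apply: (ql_rcont lp).
    exact: rmap_fun (rep_fun rN).
  move=> i; apply: rcont_sub (rmap_rcont (cf i) (rep_rcont rN)) => q x.
  by move=> [l [z Nz <-] <-]; exists z.
apply/funext => z; apply: (ql_inj lp) => i.
by rewrite hf -(congr1 (fun g => g z) (hf' i)).
Qed.

Lemma quiver_limit_ex (G : pointclass) : closed_pointclass G ->
  (forall k, continuous (@phi k)) -> (forall i, repr_space G (X i)) ->
  exists (L : topologicalType) (p : forall i, L -> X i),
    repr_space G L /\ quiver_limit p.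
Proof.
move=> clG cphi hX.
pose N i := projT1 (cid (hX i).2).
have hN i : [/\ rep (N i), radm (N i) & G _ (EQr (N i))] := projT2 (cid (hX i).2).
have rN i : rep (N i) by case: (hN i).
have aN i : radm (N i) by case: (hN i).
have GN i : G _ (EQr (N i)) by case: (hN i).
have /choice[e he] k := realizer (rN (s k)) (aN (t k)) (cphi k).
pose T := {x : forall i, X i | forall k, phi (x (s k)) = x (t k)}.
pose NT u (x : T) := forall i, N i (prj i u) (sval x i).
have eqT (x y : T) : (forall i, sval x i = sval y i) -> x = y.
  case: x y => [x hx] [y hy] /= xy; apply: eq_exist.
  exact: functional_extensionality_dep.
have fT : functional_rel NT.
  by move=> u x y Nx Ny; apply: eqT => i; exact: (rep_fun (rN i) (Nx i) (Ny i)).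
have sT x : exists u, NT u x.
  have /choice[u hu] : forall i, exists p, N i p (sval x i).
    by move=> i; exact: rep_surj (rN i) _.
  by exists (tup u) => i; rewrite prj_tup.
have rT := final_rep fT sT; pose L : topologicalType := final_space NT.
have cp i : continuous (fun x : L => sval x i).
  apply: (rep_continuous rT) => U oU u _ [x Nx <-] Ux.
  have [m hm] := rep_rcont (rN i) oU (Nx i) Ux; have [k hk] := prj_agree i m.
  by exists k => v _ uv [y Ny <-]; apply: (hm (prj i v)) (Ny i); exact: hk.
exists L, (fun i x => sval x i); split.
  apply: (rep_admissible clG _ rT).
    apply/kolmogorov_open => x y xy; apply: eqT => i.
    have /kolmogorov_open := (hX i).1; apply=> U oU.
    have /continuousP/(_ U oU) := cp i; exact: (xy (_ @^-1` U)).
  suff : definable G (fun uv : baire * baire =>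
      (forall i, EQr (N i) (prj i uv.1, prj i uv.2)) /\
      forall k, exists r, appr (e k) (prj (s k) uv.1) r /\
        EQr (N (t k)) (r, prj (t k) uv.1)).
    apply: definable_eq => -[u v] /=; split=> [[uv hk]|[x [/= Nu Nv]]]; last first.
      split=> [i|k]; first by exists (sval x i).
      have [r er Nr] := he k _ _ (Nu (s k)); exists r; split=> //.
      by exists (sval x (t k)); split=> //=; rewrite -(svalP x k).
    pose x i := projT1 (cid (uv i)).
    have Nx i : N i (prj i u) (x i) /\ N i (prj i v) (x i) := projT2 (cid (uv i)).
    have hx k : phi (x (s k)) = x (t k).
      have [r [er [y [/= Nr Nuy]]]] := hk k.
      have [r' er' Nr'] := he k _ _ (Nx (s k)).1.
      rewrite (rep_fun (rN _) (Nx (t k)).1 Nuy).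
      by rewrite (appr_fun er er') in Nr; exact: (rep_fun (rN _) Nr' Nr).
    by exists (exist _ x hx); split=> i; have [] := Nx i.
  apply: (definable_and clG); apply: (definable_forall clG) => i.
    by apply: (definable_EQ clG); prove_continuous.
  apply: (definable_ex clG); apply: (definable_and clG).
    by apply: (definable_appr clG); prove_continuous.
  by apply: (definable_EQ clG); prove_continuous.
split=> //.
- by move=> k l; exact: (svalP l k).
- by move=> x hx; exists (exist _ x hx).
move=> M fM cM.
have /choice[g hg] : forall i, exists g, gcont (dom M) g /\
    forall t x, M t x -> N i (g t) (sval x i).
  move=> i; have [g [cg hg]] := aN i _ (rmap_fun fM) (cM i).
  exists g; split=> [u [x Mx] n|u x Mx]; last by apply: hg; exists x.
  have [|k hk] := cg u _ n; first by exists (sval x i), x.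
  by exists k => v [y My] uv; apply: hk => //; exists (sval y i), y.
apply: (lift_rcont (rep_rcont rT) (g := fun u => tup (g^~ u))).
  move=> u du m; rewrite /tup; case: (unpickle m) => [[i n]|]; last by exists 0.
  by have [cg _] := hg i; exact: cg.
by move=> u x Mx i; rewrite prj_tup; have [_] := hg i; apply.
Qed.

(** * Countable colimits *)

Lemma quiver_colimit_ex (G : pointclass) : closed_pointclass G ->
  (forall k, continuous (@phi k)) -> (forall i, repr_space G (X i)) ->
  exists (L : topologicalType) (c : forall i, X i -> L),
    [/\ repr_space G L, forall i, continuous (c i),
        forall k, c (t k) \o @phi k = c (s k) &
        forall (Z : topologicalType) (f : forall i, X i -> Z), qcb0 Z ->
          (forall i, continuous (f i)) -> (forall k, f (t k) \o @phi k = f (s k)) ->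
          exists! h : L -> Z, continuous h /\ forall i, h \o c i = f i].
Proof.
move=> clG cphi hX.
pose N i := projT1 (cid (hX i).2).
have hN i : [/\ rep (N i), radm (N i) & G _ (EQr (N i))] := projT2 (cid (hX i).2).
have rN i : rep (N i) by case: (hN i).
have aN i : radm (N i) by case: (hN i).
have GN i : G _ (EQr (N i)) by case: (hN i).
have /choice[e he] k := realizer (rN (s k)) (aN (t k)) (cphi k).
pose D : set baire := [set u | exists i, bhead u = pickle i /\ EQr (N i) (btail u, btail u)].
pose R : set (baire * baire) := [set uv |
  (exists i, (bhead uv.1 = pickle i /\ bhead uv.2 = pickle i) /\
     EQr (N i) (btail uv.1, btail uv.2)) \/
  exists k, (bhead uv.1 = pickle (s k) /\ bhead uv.2 = pickle (t k)) /\
     (EQr (N (s k)) (btail uv.1, btail uv.1) /\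
      exists r, appr (e k) (btail uv.1) r /\ EQr (N (t k)) (r, btail uv.2))].
have GD : G _ D.
  apply: (definable_exists clG) => i; apply: (definable_and clG).
    by apply: (definable_head clG); prove_continuous.
  by apply: (definable_EQ clG); prove_continuous.
have GR : G _ R.
  apply: (definable_or clG); apply: (definable_exists clG) => i.
    by have GNi := GN i; prove_definable clG.
  by have GNs := GN (s i); have GNt := GN (t i); prove_definable clG.
have RD u v : R (u, v) -> D u /\ D v.
  move=> [[i [[/= ui vi] [x [/= Nu Nv]]]]|[k [[/= uk vk] [Du [r [_ [x [/= _ Nv]]]]]]]].
    by split; exists i; split=> //; exists x.
  by split; [exists (s k)|exists (t k); split=> //; exists x].
have [L [NL [GL rL DL RL univ]]] := kolmogorov_quotient clG GD GR RD.
have inD i p x : N i p x -> D (bcons (pickle i) p).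
  by move=> Nx; exists i; split=> //; exists x.
have cex i x : exists q, exists p, N i p x /\ NL (bcons (pickle i) p) q.
  have [p Np] := rep_surj (rN i) x.
  by have /DL[q Nq] := inD _ _ _ Np; exists q, p.
pose c i x := projT1 (cid (cex i x)).
have hc i x : exists p, N i p x /\ NL (bcons (pickle i) p) (c i x).
  exact: (projT2 (cid (cex i x))).
have cE i p x q : N i p x -> NL (bcons (pickle i) p) q -> c i x = q.
  move=> Nx Nq; have [p' [Nx' Nq']] := hc i x.
  by apply: (RL _ _ _ _ Nq' Nq); left; exists i; split=> //; exists x.
have Nc i p x : N i p x -> NL (bcons (pickle i) p) (c i x).
  by move=> Nx; have /DL[q Nq] := inD _ _ _ Nx; rewrite (cE _ _ _ _ Nx Nq).
exists L, c; split=> //.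
- move=> i; apply: (rep_continuous (rN i)) => U oU p _ [x Nx <-] Ux.
  have [k hk] := rep_rcont rL oU (Nc _ _ _ Nx) Ux.
  exists k => q _ pq [y Ny <-]; apply: hk (Nc _ _ _ Ny).
  exact: agree_le (agree_bcons _ pq).
- move=> k; apply/funext => x /=; have [p Np] := rep_surj (rN (s k)) x.
  have [r er Nr] := he k _ _ Np.
  apply/esym; apply: (RL _ _ _ _ (Nc _ _ _ Np) (Nc _ _ _ Nr)); right; exists k; split=> //.
  by split; [exists x|exists r; split=> //; exists (phi x)].
move=> Z f qZ cf ff.
pose M u z := exists i x, [/\ bhead u = pickle i, N i (btail u) x & f i x = z].
have fM : functional_rel M.
  move=> u z z' [i [x [ui Nx <-]]] [j [y [uj Ny <-]]].
  have ij : i = j by apply: (pcan_inj pickleK); rewrite -ui.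
  by subst j; rewrite (rep_fun (rN i) Nx Ny).
have cM : rcont M.
  move=> U oU u z [i [x [ui Nx <-]]] Ux.
  have Mx : rmap (f i) (N i) (btail u) (f i x) by exists x.
  have [k hk] := rmap_rcont (cf i) (rep_rcont (rN i)) oU Mx Ux.
  exists k.+1 => v w uv [j [y [vj Ny <-]]].
  have ij : i = j by apply: (pcan_inj pickleK); rewrite -ui -vj; exact: uv.
  by subst j; apply: hk (agree_btail uv) _; exists y.
have dM u : dom M u <-> D u.
  split=> [[z [i [x [ui Nx _]]]]|[i [ui [x [Nx _]]]]].
    by exists i; split=> //; exists x.
  by exists (f i x), i, x.
have RM u v x y : M u x -> M v y -> R (u, v) -> x = y.
  move=> Mu Mv [[i [[/= ui vi] [a [/= Na Nb]]]]|[k [[/= uk vk] [[a [/= Na _]] [r [er [b [/= Nr Nb]]]]]]]].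
    have Mu' : M u (f i a) by exists i, a.
    have Mv' : M v (f i a) by exists i, a.
    by rewrite (fM _ _ _ Mu Mu') (fM _ _ _ Mv Mv').
  have Mu' : M u (f _ a) by exists (s k), a.
  have Mv' : M v (f _ b) by exists (t k), b.
  rewrite (fM _ _ _ Mu Mu') (fM _ _ _ Mv Mv') -(ff k) /=; congr f.
  have [r' er' Nr'] := he k _ _ Na.
  by rewrite (appr_fun er er') in Nr; exact: (rep_fun (rN _) Nr' Nr).
have [h [ch hE]] := univ Z M (proj1 qZ) cM dM fM RM.
have hf i x : h (c i x) = f i x.
  have [p Np] := rep_surj (rN i) x; apply: (hE _ _ _ (Nc _ _ _ Np)).
  by exists i, x.
exists h; split=> [|h' [_ hf']]; first by split=> // i; apply/funext => x; exact: hf.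
apply/funext => q; have [u Nu] := rep_surj rL q.
have [i [ui [x [Nx _]]]] : D u by apply/DL; exists q.
have uE : u = bcons (pickle i) (btail u) by apply/funext => -[|n].
rewrite uE in Nu; rewrite -(cE _ _ _ _ Nx Nu) hf.
by rewrite -(congr1 (fun g => g x) (hf' i)).
Qed.

End QuiverLimit.
Arguments ql_cont {I K X s t phi L p} _ i.

(** * Function spaces *)

Record function_space (X Y E : topologicalType) (app : E -> X -> Y) : Prop :=
  FunctionSpace {
  fs_cont : forall f, continuous (app f);
  fs_ex : forall f : X -> Y, continuous f -> exists e, app e = f;
  fs_inj : injective app;
  fs_ev : forall (T : topologicalType) (M : baire -> T -> Prop) (a : T -> E) (b : T -> X),
    functional_rel M -> rcont (rmap a M) -> rcont (rmap b M) ->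
    rcont (rmap (fun x => app (a x) (b x)) M);
  fs_curry : forall (T : topologicalType) (M : baire -> T -> Prop) (c : T -> E),
    functional_rel M ->
    (forall N : baire -> X -> Prop, rep N -> rcont (fun w y => exists z x,
      [/\ M (prj true w) z, N (prj false w) x & app (c z) x = y])) ->
    rcont (rmap c M) }.

Lemma function_space_ex (G : pointclass) (X Y : topologicalType) :
  closed_pointclass G -> repr_space G X -> repr_space G Y ->
  exists (E : topologicalType) (app : E -> X -> Y),
    repr_space G E /\ function_space app.
Proof.
move=> clG [T0X [NX [rX aX GX]]] [/kolmogorov_open T0Y [NY [rY aY GY]]].
pose E0 := {f : X -> Y | continuous f}.
pose N e (f : E0) := forall p x, NX p x -> exists2 r, appr e p r & NY r (sval f x).
have fN : functional_rel N.
  move=> e [f cf] [g cg] Nf Ng; apply: eq_exist; apply/funext => x.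
  have [p Np] := rep_surj rX x; have [r er Nr] := Nf _ _ Np.
  have [r' er' Nr'] := Ng _ _ Np.
  by rewrite (appr_fun er er') in Nr; exact: (rep_fun rY Nr Nr').
have sN f : exists e, N e f by exact: realizer rX aY (svalP f).
have rE := final_rep fN sN; pose E : topologicalType := final_space N.
pose app (f : E) := sval f.
have joint U : open U -> forall e f p x, N e f -> NX p x -> U (app f x) ->
    exists k, forall e' f' p' x', agree k e e' -> agree k p p' ->
      N e' f' -> NX p' x' -> U (app f' x').
  move=> oU e f p x Nf Nx Ux; have [r er Nr] := Nf _ _ Nx.
  have [m hm] := rep_rcont rY oU Nr Ux; have [k hk] := appr_cont m er.
  exists k => e' f' p' x' ee pp Nf' Nx'; have [r' er' Nr'] := Nf' _ _ Nx'.
  by apply: hm Nr'; exact: hk er'.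
have injE (f g : E) : (forall x, app f x = app g x) -> f = g.
  by case: f g => [f cf] [g cg] fg; apply: eq_exist; apply/funext.
have curry (T : topologicalType) (M : baire -> T -> Prop) (c : T -> E) :
    functional_rel M -> rcont (fun w y => exists z x,
      [/\ M (prj true w) z, NX (prj false w) x & app (c z) x = y]) ->
    exists g, gcont (dom M) g /\ forall t z, M t z -> N (g t) (c z).
  move=> fM cM; pose W w y := exists z x,
      [/\ M (prj true w) z, NX (prj false w) x & app (c z) x = y].
  have fW : functional_rel W.
    move=> w y y' [z [x [Mz Nx <-]]] [z' [x' [Mz' Nx' <-]]].
    by rewrite (fM _ _ _ Mz Mz') (rep_fun rX Nx Nx').
  have [g [cg hg]] := aY W fW cM.
  pose pr t p := tup (fun b : bool => if b then t else p).
  have prW t p z x : M t z -> NX p x -> W (pr t p) (app (c z) x).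
    by move=> Mz Nx; exists z, x; rewrite !prj_tup.
  have pr_agree m : exists k, forall t p t' p', agree k t t' -> agree k p p' ->
      agree m (pr t p) (pr t' p').
    have [||k hk] := @uniform_bound (fun m k => forall t p t' p', agree k t t' ->
        agree k p p' -> pr t p m = pr t' p' m) _ _ m.
    - move=> n j k jk h t p t' p' tt pp; apply: h.
        exact: agree_le tt.
      exact: agree_le pp.
    - move=> n; rewrite /pr /tup; case: (unpickle n) => [[b l]|]; last by exists 0.
      by exists l.+1 => t p t' p' tt pp; case: b; [exact: tt|exact: pp].
    by exists k => t p t' p' tt pp i im; exact: hk.
  have [|H [cH hH]] := @smn_app (fun t p => dom M t /\ dom NX p)
      (fun t p => g (pr t p)).
    move=> t p [[z Mz] [x Nx]] n.
    have [|m hm] := cg (pr t p) _ n; first by exists (app (c z) x); exact: prW.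
    have [k hk] := pr_agree m; exists k => t' p' [[z' Mz'] [x' Nx']] tt pp.
    by apply: hm; [exists (app (c z') x'); exact: prW|exact: hk].
  exists H; split; first exact: ucont_gcont.
  move=> t z Mz p x Nx; exists (g (pr t p)).
    by apply: hH; split; [exists z|exists x].
  exact: hg (prW _ _ _ _ Mz Nx).
have aE : @radm E N.
  move=> M fM cM; apply: (curry E M id fM) => U oU w y [f [x [Mf Nx <-]]] Ux.
  have := evaluation_open rE (V := fun f x => U (app f x)) (NB := NX) _ cM Mf Nx Ux.
  case=> [e f' p x' Nf' Nx' Ux'|m hm].
    by have [k hk] := joint U oU _ _ _ _ Nf' Nx' Ux'; exists k => e' g p' z *; apply: (hk e' g p' z).
  have [k hk] := prj_agree true m; have [l hl] := prj_agree false m.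
  exists (maxn k l) => w' y' /agree_max[wk wl] [f' [x' [Mf' Nx' <-]]].
  by apply: hm Mf' Nx'; [exact: hk|exact: hl].
exists E, app; split.
  split.
    apply/kolmogorov_open => f g fg; apply: injE => x; apply: T0Y => U oU.
    apply: (fg [set f | U (app f x)]); apply/(rep_open rE) => e f0 Nf Ux.
    have [p Np] := rep_surj rX x; have [k hk] := joint U oU _ _ _ _ Nf Np Ux.
    by exists k => e' f' ee Nf'; exact: (hk _ _ _ _ ee (@agree_refl k p) Nf' Np).
  exists N; split=> //.
  suff : definable G (fun ee : baire * baire => forall p p', EQr NX (p, p') ->
      exists r r', (appr ee.1 p r /\ appr ee.2 p' r') /\ EQr NY (r, r')).
    apply: definable_eq => -[e e'] /=; split=> [h|[f [/= Nf Nf']] p p' [x [/= Np Np']]]; last first.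
      have [r er Nr] := Nf _ _ Np; have [r' er' Nr'] := Nf' _ _ Np'.
      by exists r, r'; split=> //; exists (sval f x).
    have hE p p' x : NX p x -> NX p' x -> exists r r' y,
        [/\ appr e p r, appr e' p' r', NY r y & NY r' y].
      move=> Np Np'; have [|r [r' [[er er'] [y [Nr Nr']]]]] := h p p'; first by exists x.
      by exists r, r', y.
    have /choice[f hf] : forall x, exists y, forall p, NX p x ->
        exists r r', [/\ appr e p r, appr e' p r', NY r y & NY r' y].
      move=> x; have [p0 Np0] := rep_surj rX x.
      have [r0 [r0' [y0 [er0 er0' Nr0 Nr0']]]] := hE _ _ _ Np0 Np0.
      exists y0 => p Np; have [r [r' [y [er er' Nr Nr']]]] := hE _ _ _ Np Np.
      have [r1 [r1' [y1 [er1 er1' Nr1 Nr1']]]] := hE _ _ _ Np Np0.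
      suff yy : y = y0 by rewrite yy in Nr Nr'; exists r, r'.
      rewrite (appr_fun er1 er) in Nr1; rewrite (appr_fun er1' er0') in Nr1'.
      by rewrite (rep_fun rY Nr Nr1) (rep_fun rY Nr0' Nr1').
    have cf : continuous f.
      apply: (rep_continuous rX).
      apply: (@realized_rcont _ X _ _ _ _ (fun=> e) id (rep_rcont rY)).
      - by move=> t _ n; exists 0.
      - by move=> t _ n; exists n.+1 => t' _; apply.
      by move=> p x Np; have [r [r' [er _ Nr _]]] := hf x p Np; exists r.
    exists (exist _ f cf); split=> p x Np; have [r [r' [er er' Nr Nr']]] := hf x p Np.
      by exists r.
    by exists r'.
  prove_definable clG.
split.
- by move=> f; exact: (svalP f).
- by move=> f cf; exists (exist _ f cf).
- by move=> f g fg; apply: injE => x; rewrite fg.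
- move=> T M a b fM ca cb.
  have [A [cA hA]] := aE _ (rmap_fun fM) ca; have [B [cB hB]] := aX _ (rmap_fun fM) cb.
  have dM (S : Type) (d : T -> S) u : dom M u -> dom (rmap d M) u.
    by move=> [x Mx]; exists (d x), x.
  apply: (@realized_rcont _ X _ _ _ _ A B (rep_rcont rY)).
  + move=> u du n; have [k hk] := cA u (dM _ _ _ du) n.
    by exists k => v dv; apply: hk; exact: dM.
  + move=> u du n; have [k hk] := cB u (dM _ _ _ du) n.
    by exists k => v dv; apply: hk; exact: dM.
  move=> u x Mx; have Na : N (A u) (a x) by apply: hA; exists x.
  by apply: Na; apply: hB; exists x.
move=> T M c fM /(_ NX rX) cM; have [g [cg hg]] := curry T M c fM cM.
apply: (lift_rcont (rep_rcont rE) (g := g)).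
  move=> u [f [z Mz _]] n; have [|k hk] := cg u _ n; first by exists z.
  by exists k => v [_ [z' Mz' _]]; apply: hk; exists z'.
by move=> u _ [z Mz <-]; exact: hg.
Qed.

(** * Universal constructions *)

Lemma unique_iso (A B : topologicalType) (SAA : (A -> A) -> Prop)
    (SBB : (B -> B) -> Prop) (SAB : (A -> B) -> Prop) (SBA : (B -> A) -> Prop) :
  (exists! h, SAA h) -> (exists! h, SBB h) ->
  (exists! h, SAB h) -> (exists! h, SBA h) ->
  SAA id -> SBB id ->
  (forall f g, SAB f -> SBA g -> SAA (g \o f)) ->
  (forall f g, SAB f -> SBA g -> SBB (f \o g)) ->
  exists (f : A -> B) (g : B -> A), [/\ SAB f, SBA g, cancel f g & cancel g f].
Proof.
move=> [a [_ ua]] [b [_ ub]] [f [Sf _]] [g [Sg _]] SA SB SAf SBf.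
have gf : g \o f = id by rewrite -(ua _ (SAf _ _ Sf Sg)) (ua _ SA).
have fg : f \o g = id by rewrite -(ub _ (SBf _ _ Sf Sg)) (ub _ SB).
by exists f, g; split=> // x; [exact: (congr1 (fun h => h x) gf)|exact: (congr1 (fun h => h x) fg)].
Qed.

Lemma comp_continuous (X Y Z : topologicalType) (g : Y -> Z) (f : X -> Y) :
  continuous f -> continuous g -> continuous (g \o f).
Proof. by move=> cf cg x; apply: continuous_comp; [exact: cf|exact: cg]. Qed.

Definition bool_fam (X Y : topologicalType) (b : bool) : topologicalType :=
  if b then X else Y.

Definition bool_map (Z X Y : topologicalType) (f : Z -> X) (g : Z -> Y) (b : bool) :
    Z -> bool_fam X Y b :=
  if b return Z -> bool_fam X Y b then f else g.

(** ** Binary products *)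

Record pairing (X Y P : topologicalType) (p1 : P -> X) (p2 : P -> Y) : Prop :=
  Pairing {
  pr_cont1 : continuous p1;
  pr_cont2 : continuous p2;
  pr_inj : forall l l', p1 l = p1 l' -> p2 l = p2 l' -> l = l';
  pr_rcont : forall M : baire -> P -> Prop, functional_rel M ->
    rcont (rmap p1 M) -> rcont (rmap p2 M) -> rcont M;
  pr_univ : forall (Z : topologicalType) (f : Z -> X) (g : Z -> Y), qcb0 Z ->
    continuous f -> continuous g ->
    exists! h : Z -> P, [/\ continuous h, p1 \o h = f & p2 \o h = g] }.

Lemma pairing_ex (G : pointclass) (X Y : topologicalType) :
  closed_pointclass G -> repr_space G X -> repr_space G Y ->
  exists (P : topologicalType) (p1 : P -> X) (p2 : P -> Y),
    repr_space G P /\ pairing p1 p2.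
Proof.
move=> clG GX GY.
have [||P [p [GP lp]]] := @quiver_limit_ex bool void (bool_fam X Y)
    (fun k => match k with end) (fun k => match k with end) (fun k => match k with end) G clG.
- by case.
- by case.
exists P, (p true), (p false); split=> //; split.
- exact: (ql_cont lp true).
- exact: (ql_cont lp false).
- by move=> l l' h1 h2; apply: (ql_inj lp) => -[].
- by move=> M fM c1 c2; apply: (ql_rcont lp fM) => -[].
move=> Z f g qZ cf cg.
have [||h [[ch hp] uh]] := quiver_limit_universal lp (f := bool_map f g) qZ.
- by case.
- by case.
exists h; split=> [|h' [ch' h1 h2]].
  by split=> //; [exact: (hp true)|exact: (hp false)].
by apply: uh; split=> // -[].
Qed.

Lemma pairing_binprod (C : space_class) (X Y P : topologicalType)
    (p1 : P -> X) (p2 : P -> Y) :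
  (forall X, C X -> qcb0 X) -> C P -> pairing p1 p2 -> is_binprod C p1 p2.
Proof.
move=> Cq CP lp; split=> //; [exact: pr_cont1 lp|exact: pr_cont2 lp|].
by move=> Z f g /Cq qZ cf cg; exact: (pr_univ lp qZ cf cg).
Qed.

Lemma binprod_iso (C : space_class) (X Y P Q : topologicalType)
    (p1 : P -> X) (p2 : P -> Y) (q1 : Q -> X) (q2 : Q -> Y) :
  is_binprod C p1 p2 -> is_binprod C q1 q2 ->
  exists (f : P -> Q) (g : Q -> P),
    [/\ [/\ continuous f, q1 \o f = p1 & q2 \o f = p2],
        [/\ continuous g, p1 \o g = q1 & p2 \o g = q2], cancel f g & cancel g f].
Proof.
move=> [CP cp1 cp2 up] [CQ cq1 cq2 uq].
apply: (unique_iso (up P p1 p2 CP cp1 cp2) (uq Q q1 q2 CQ cq1 cq2)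
  (uq P p1 p2 CP cp1 cp2) (up Q q1 q2 CQ cq1 cq2)).
- by split=> //; exact: idfun_continuous.
- by split=> //; exact: idfun_continuous.
- move=> f g [cf f1 f2] [cg g1 g2]; split; first exact: comp_continuous.
    by rewrite compA g1.
  by rewrite compA g2.
- move=> f g [cf f1 f2] [cg g1 g2]; split; first exact: comp_continuous.
    by rewrite compA f1.
  by rewrite compA f2.
Qed.

Lemma binprod_transport (C : space_class) (X Y P Q : topologicalType)
    (p1 : P -> X) (p2 : P -> Y) (q1 : Q -> X) (q2 : Q -> Y) :
  (forall X, C X -> qcb0 X) -> C P -> pairing p1 p2 -> is_binprod C q1 q2 ->
  is_binprod qcb0 q1 q2.
Proof.
move=> Cq CP lp bq.
have [f [g [[cf f1 f2] [cg g1 g2] fg gf]]] := binprod_iso (pairing_binprod Cq CP lp) bq.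
have [CQ cq1 cq2 _] := bq; split=> //; first exact: Cq.
move=> Z a b qZ ca cb; have [h [[ch h1 h2] uh]] := pr_univ lp qZ ca cb.
exists (f \o h); split=> [|k [ck k1 k2]].
  by split; [exact: comp_continuous|rewrite compA f1|rewrite compA f2].
rewrite (uh (g \o k)); first by apply/funext => z /=; rewrite gf.
by split; [exact: comp_continuous|rewrite compA g1|rewrite compA g2].
Qed.

(** ** Exponentials *)

Lemma exponential_function_space (C : space_class) (X Y E P : topologicalType)
    (app : E -> X -> Y) (p1 : P -> E) (p2 : P -> X) :
  (forall X, C X -> qcb0 X) -> C E -> C P -> C X ->
  (forall Z, C Z -> exists (Q : topologicalType) (q1 : Q -> Z) (q2 : Q -> X),
     C Q /\ pairing q1 q2) ->
  function_space app -> pairing p1 p2 ->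
  is_exponential C p1 p2 (fun w => app (p1 w) (p2 w)).
Proof.
move=> Cq CE CP CX Cprod fs lp; split=> //; first exact: pairing_binprod.
  have [N rN] := rep_of_qcb0 (Cq _ CP); apply: (rep_continuous rN).
  apply: (fs_ev fs); first exact: rep_fun rN.
    exact: rmap_rcont (pr_cont1 lp) (rep_rcont rN).
  exact: rmap_rcont (pr_cont2 lp) (rep_rcont rN).
move=> Z Q q1 q2 f CZ bq cf.
have [P0 [r1 [r2 [CP0 lr]]]] := Cprod Z CZ.
have [psi [theta [[cpsi psi1 psi2] [ctheta theta1 theta2] _ psiK]]] :=
  binprod_iso (pairing_binprod Cq CP0 lr) bq.
have [CQ cq1 cq2 _] := bq.
have slice z : exists j : X -> P0, [/\ continuous j, r1 \o j = cst z & r2 \o j = id].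
  have [j [hj _]] := pr_univ lr (Cq _ CX) (@cst_continuous _ _ z) (@idfun_continuous X).
  by exists j.
have /choice[j hj] := slice.
have r1j z x : r1 (j z x) = z.
  by have [_ h _] := hj z; exact: (congr1 (fun f => f x) h).
have r2j z x : r2 (j z x) = x.
  by have [_ _ h] := hj z; exact: (congr1 (fun f => f x) h).
have /choice[h hE] : forall z, exists e, app e = f \o (psi \o j z).
  move=> z; apply: (fs_ex fs); apply: comp_continuous cf.
  by apply: comp_continuous cpsi; case: (hj z).
have thetaE w : j (q1 w) (q2 w) = theta w.
  apply: (pr_inj lr); rewrite ?r1j ?r2j.
    by rewrite -[q1 in LHS]theta1.
  by rewrite -[q2 in LHS]theta2.
have ch : continuous h.
  have [NZ rZ] := rep_of_qcb0 (Cq _ CZ); apply: (rep_continuous rZ).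
  apply: (fs_curry fs); first exact: rep_fun rZ.
  move=> NX rX.
  pose M w l := NZ (prj true w) (r1 l) /\ NX (prj false w) (r2 l).
  have fM : functional_rel M.
    move=> w l l' [a b] [a' b']; apply: (pr_inj lr).
      exact: (rep_fun rZ a a').
    exact: (rep_fun rX b b').
  have cM : rcont M.
    apply: (pr_rcont lr fM) => U oU w _ [l [Nl Nl'] <-] Ul.
      have [m hm] := rep_rcont rZ oU Nl Ul; have [k hk] := prj_agree true m.
      by exists k => w' _ ww [l' [Ml' _] <-]; apply: hm Ml'; exact: hk.
    have [m hm] := rep_rcont rX oU Nl' Ul; have [k hk] := prj_agree false m.
    by exists k => w' _ ww [l' [_ Ml'] <-]; apply: hm Ml'; exact: hk.
  apply: rcont_sub (rmap_rcont (comp_continuous cpsi cf) cM) => w y.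
  move=> [z [x [Mz Nx <-]]]; exists (j z x); last by rewrite hE.
  by split; rewrite ?r1j ?r2j.
exists h; split=> [|h' [ch' [k [ck k1 k2 kf]]]].
  split=> //.
  have [k [[ck k1 k2] _]] := pr_univ lp (Cq _ CQ) (comp_continuous cq1 ch) cq2.
  exists k; split=> //; apply/funext => w /=.
  rewrite (congr1 (fun g => g w) k1 : p1 (k w) = h (q1 w)).
  rewrite (congr1 (fun g => g w) k2 : p2 (k w) = q2 w).
  by rewrite hE /= thetaE psiK.
apply/funext => z; apply: (fs_inj fs); apply/funext => x.
rewrite hE -kf /=.
rewrite (congr1 (fun g => g (psi (j z x))) k1 : p1 _ = _).
rewrite (congr1 (fun g => g (psi (j z x))) k2 : p2 _ = _) /=.
have -> : q1 (psi (j z x)) = r1 (j z x) by rewrite -psi1.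
have -> : q2 (psi (j z x)) = r2 (j z x) by rewrite -psi2.
by rewrite r1j r2j.
Qed.

Lemma exponential_iso (C : space_class) (X Y E P E' P' : topologicalType)
    (p1 : P -> E) (p2 : P -> X) (ev : P -> Y)
    (p1' : P' -> E') (p2' : P' -> X) (ev' : P' -> Y) :
  is_exponential C p1 p2 ev -> is_exponential C p1' p2' ev' ->
  exists (f : E -> E') (g : E' -> E),
    [/\ continuous f, continuous g, cancel f g & cancel g f].
Proof.
move=> [CE bp cev u] [CE' bp' cev' u'].
have [||||f [g [[cf _] [cg _] fg gf]]] := unique_iso (u _ _ _ _ _ CE bp cev)
  (u' _ _ _ _ _ CE' bp' cev') (u' _ _ _ _ _ CE bp cev) (u _ _ _ _ _ CE' bp' cev').
- split; first exact: idfun_continuous.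
  by exists id; split=> //; exact: idfun_continuous.
- split; first exact: idfun_continuous.
  by exists id; split=> //; exact: idfun_continuous.
- move=> f g [cf [k [ck k1 k2 kf]]] [cg [l [cl l1 l2 lf]]].
  split; first exact: comp_continuous.
  exists (l \o k); split; first exact: comp_continuous.
  + by rewrite compA l1 -compA k1.
  + by rewrite compA l2.
  + by rewrite compA lf.
- move=> f g [cf [k [ck k1 k2 kf]]] [cg [l [cl l1 l2 lf]]].
  split; first exact: comp_continuous.
  exists (k \o l); split; first exact: comp_continuous.
  + by rewrite compA k1 -compA l1.
  + by rewrite compA k2.
  + by rewrite compA kf.
by exists f, g.
Qed.

(** ** Products and coproducts, equalizers and coequalizers *)

Lemma qcb0_hp_homeo (X Y : topologicalType) (f : X -> Y) (g : Y -> X) :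
  continuous f -> continuous g -> cancel f g -> cancel g f ->
  qcb0_hp X -> qcb0_hp Y.
Proof.
move=> cf cg fg gf /qcb0_of_hyperprojective h; apply/qcb0_of_hyperprojective.
exact: repr_space_homeo cf cg fg gf h.
Qed.

Lemma product_ex (I : countType) (X : I -> topologicalType) :
  (forall i, qcb0_hp (X i)) ->
  exists (P : topologicalType) (p : forall i, P -> X i),
    qcb0_hp P /\ is_product qcb0 p.
Proof.
move=> hX; have [||P [p [GP lp]]] := @quiver_limit_ex I void X
    (fun k => match k with end) (fun k => match k with end) (fun k => match k with end)
    _ hyperprojective_closed.
- by case.
- by move=> i; apply/qcb0_of_hyperprojective.
exists P, p; split; first exact/qcb0_of_hyperprojective.
split; [exact: repr_space_qcb0 GP|exact: (ql_cont lp)|].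
by move=> Z f qZ cf; apply: (quiver_limit_universal lp) => // -[].
Qed.

Lemma product_hp (I : countType) (X : I -> topologicalType)
    (P : topologicalType) (p : forall i, P -> X i) :
  (forall i, qcb0_hp (X i)) -> is_product qcb0 p -> is_product qcb0_hp p.
Proof.
move=> /product_ex[Q [q [hQ [qQ cq uq]]]] [qP cp up].
have [||||f [g [[cf _] [cg _] fg gf]]] := unique_iso (uq Q q qQ cq) (up P p qP cp)
  (up Q q qQ cq) (uq P p qP cp).
- by split=> //; exact: idfun_continuous.
- by split=> //; exact: idfun_continuous.
- move=> f g [cf hf] [cg hg]; split=> [|i]; first exact: comp_continuous.
  by rewrite compA hg.
- move=> f g [cf hf] [cg hg]; split=> [|i]; first exact: comp_continuous.
  by rewrite compA hf.
split=> // [|Z h /qcb0_hp_qcb0]; last exact: up.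
exact: qcb0_hp_homeo cf cg fg gf hQ.
Qed.

Lemma coproduct_ex (I : countType) (X : I -> topologicalType) :
  (forall i, qcb0_hp (X i)) ->
  exists (S : topologicalType) (s : forall i, X i -> S),
    qcb0_hp S /\ is_coproduct qcb0 s.
Proof.
move=> hX; have [||S [s [GS cs _ us]]] := @quiver_colimit_ex I void X
    (fun k => match k with end) (fun k => match k with end) (fun k => match k with end)
    _ hyperprojective_closed.
- by case.
- by move=> i; apply/qcb0_of_hyperprojective.
exists S, s; split; first exact/qcb0_of_hyperprojective.
split=> //; first exact: repr_space_qcb0 GS.
by move=> Z f qZ cf; apply: us => // -[].
Qed.

Lemma coproduct_hp (I : countType) (X : I -> topologicalType)
    (S : topologicalType) (s : forall i, X i -> S) :
  (forall i, qcb0_hp (X i)) -> is_coproduct qcb0 s -> is_coproduct qcb0_hp s.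
Proof.
move=> /coproduct_ex[Q [q [hQ [qQ cq uq]]]] [qS cs us].
have [||||f [g [[cf _] [cg _] fg gf]]] := unique_iso (uq Q q qQ cq) (us S s qS cs)
  (uq S s qS cs) (us Q q qQ cq).
- by split=> //; exact: idfun_continuous.
- by split=> //; exact: idfun_continuous.
- move=> f g [cf hf] [cg hg]; split=> [|i]; first exact: comp_continuous.
  by rewrite -compA hf.
- move=> f g [cf hf] [cg hg]; split=> [|i]; first exact: comp_continuous.
  by rewrite -compA hg.
split=> // [|Z h /qcb0_hp_qcb0]; last exact: us.
exact: qcb0_hp_homeo cf cg fg gf hQ.
Qed.

Lemma equalizer_ex (X Y : topologicalType) (f g : X -> Y) :
  qcb0_hp X -> qcb0_hp Y -> continuous f -> continuous g ->
  exists (E : topologicalType) (e : E -> X),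
    qcb0_hp E /\ is_equalizer qcb0 f g e.
Proof.
move=> hX hY cf cg; have [||E [p [GE lp]]] := @quiver_limit_ex bool bool
    (bool_fam X Y) (fun=> true) (fun=> false) (fun k => if k then f else g)
    _ hyperprojective_closed.
- by case.
- by case; apply/qcb0_of_hyperprojective.
have fE l : f (p true l) = p false l := ql_cone lp true l.
have gE l : g (p true l) = p false l := ql_cone lp false l.
exists E, (p true); split; first exact/qcb0_of_hyperprojective.
split; [exact: repr_space_qcb0 GE|exact: (ql_cont lp true)| |].
  by apply/funext => l /=; rewrite fE gE.
move=> Z k qZ ck fgk.
have [||h [[ch hp] uh]] := quiver_limit_universal lp (f := bool_map k (f \o k)) qZ.
- by case=> //=; exact: comp_continuous.
- by case.
exists h; split=> [|h' [ch' h1]]; first by split=> //; exact: (hp true).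
apply: uh; split=> // -[] //=; rewrite -h1; apply/funext => z /=.
by rewrite fE.
Qed.

Lemma equalizer_hp (X Y : topologicalType) (f g : X -> Y)
    (E : topologicalType) (e : E -> X) :
  qcb0_hp X -> qcb0_hp Y -> continuous f -> continuous g ->
  is_equalizer qcb0 f g e -> is_equalizer qcb0_hp f g e.
Proof.
move=> hX hY cf cg [qE ce ee ue].
have [Q [q [hQ [qQ cq eq uq]]]] := equalizer_ex hX hY cf cg.
have [||||a [b [[ca _] [cb _] ab ba]]] := unique_iso (uq Q q qQ cq eq)
  (ue E e qE ce ee) (ue Q q qQ cq eq) (uq E e qE ce ee).
- by split=> //; exact: idfun_continuous.
- by split=> //; exact: idfun_continuous.
- move=> a b [ca ha] [cb hb]; split; first exact: comp_continuous.
  by rewrite compA hb.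
- move=> a b [ca ha] [cb hb]; split; first exact: comp_continuous.
  by rewrite compA ha.
split=> // [|Z h /qcb0_hp_qcb0]; last exact: ue.
exact: qcb0_hp_homeo ca cb ab ba hQ.
Qed.

Lemma coequalizer_ex (X Y : topologicalType) (f g : X -> Y) :
  qcb0_hp X -> qcb0_hp Y -> continuous f -> continuous g ->
  exists (Q : topologicalType) (q : Y -> Q),
    qcb0_hp Q /\ is_coequalizer qcb0 f g q.
Proof.
move=> hX hY cf cg; have [||Q [c [GQ cc ec uc]]] := @quiver_colimit_ex bool bool
    (bool_fam X Y) (fun=> true) (fun=> false) (fun k => if k then f else g)
    _ hyperprojective_closed.
- by case.
- by case; apply/qcb0_of_hyperprojective.
have fE : c false \o f = c true := ec true.
have gE : c false \o g = c true := ec false.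
exists Q, (c false); split; first exact/qcb0_of_hyperprojective.
split; [exact: repr_space_qcb0 GQ|exact: (cc false)|by rewrite fE gE|].
move=> Z k qZ ck fgk.
pose fam (b : bool) : bool_fam X Y b -> Z :=
  if b return bool_fam X Y b -> Z then k \o f else k.
have [||h [[ch hp] uh]] := uc Z fam qZ.
- by case=> //=; exact: comp_continuous.
- by case.
exists h; split=> [|h' [ch' h1]]; first by split=> //; exact: (hp false).
apply: uh; split=> // -[] //=.
by rewrite -fE compA h1.
Qed.

Lemma coequalizer_hp (X Y : topologicalType) (f g : X -> Y)
    (E : topologicalType) (e : Y -> E) :
  qcb0_hp X -> qcb0_hp Y -> continuous f -> continuous g ->
  is_coequalizer qcb0 f g e -> is_coequalizer qcb0_hp f g e.
Proof.
move=> hX hY cf cg [qE ce ee ue].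
have [Q [q [hQ [qQ cq eq uq]]]] := coequalizer_ex hX hY cf cg.
have [||||a [b [[ca _] [cb _] ab ba]]] := unique_iso (uq Q q qQ cq eq)
  (ue E e qE ce ee) (uq E e qE ce ee) (ue Q q qQ cq eq).
- by split=> //; exact: idfun_continuous.
- by split=> //; exact: idfun_continuous.
- move=> a b [ca ha] [cb hb]; split; first exact: comp_continuous.
  by rewrite -compA ha.
- move=> a b [ca ha] [cb hb]; split; first exact: comp_continuous.
  by rewrite -compA hb.
split=> // [|Z h /qcb0_hp_qcb0]; last exact: ue.
exact: qcb0_hp_homeo ca cb ab ba hQ.
Qed.

Lemma pairing_hp (X Y : topologicalType) : qcb0_hp X -> qcb0_hp Y ->
  exists (P : topologicalType) (p1 : P -> X) (p2 : P -> Y),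
    qcb0_hp P /\ pairing p1 p2.
Proof.
move=> /qcb0_of_hyperprojective hX /qcb0_of_hyperprojective hY.
have [P [p1 [p2 [GP lp]]]] := pairing_ex hyperprojective_closed hX hY.
by exists P, p1, p2; split=> //; apply/qcb0_of_hyperprojective.
Qed.

Lemma pairing_qcb0 (X Y : topologicalType) : qcb0 X -> qcb0 Y ->
  exists (P : topologicalType) (p1 : P -> X) (p2 : P -> Y),
    qcb0 P /\ pairing p1 p2.
Proof.
move=> /qcb0_repr_space hX /qcb0_repr_space hY.
have [P [p1 [p2 [GP lp]]]] := pairing_ex closed_everything hX hY.
by exists P, p1, p2; split=> //; apply/qcb0_repr_space.
Qed.

Lemma exponential_ex (X Y : topologicalType) : qcb0_hp X -> qcb0_hp Y ->
  exists (E P : topologicalType) (p1 : P -> E) (p2 : P -> X) (ev : P -> Y),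
    is_exponential qcb0_hp p1 p2 ev /\ is_exponential qcb0 p1 p2 ev.
Proof.
move=> hX hY; have [E [app [GE fs]]] := function_space_ex hyperprojective_closed
  (iffLR (qcb0_of_hyperprojective X) hX) (iffLR (qcb0_of_hyperprojective Y) hY).
have hE : qcb0_hp E by apply/qcb0_of_hyperprojective.
have [P [p1 [p2 [hP lp]]]] := pairing_hp hE hX.
exists E, P, p1, p2, (fun w => app (p1 w) (p2 w)).
split; apply: exponential_function_space fs lp => //; try exact: qcb0_hp_qcb0.
  by move=> Z hZ; exact: pairing_hp.
by move=> Z qZ; apply: pairing_qcb0 => //; exact: qcb0_hp_qcb0.
Qed.

Lemma exponential_hp (X Y E P : topologicalType) (p1 : P -> E) (p2 : P -> X)
    (ev : P -> Y) :
  qcb0_hp X -> qcb0_hp Y -> is_exponential qcb0 p1 p2 ev ->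
  is_exponential qcb0_hp p1 p2 ev.
Proof.
move=> hX hY xE; have [E0 [P0 [r1 [r2 [ev0 [[hE0 _ _ _] xE0]]]]]] := exponential_ex hX hY.
have [f [g [cf cg fg gf]]] := exponential_iso xE0 xE.
have hE : qcb0_hp E by exact: qcb0_hp_homeo cf cg fg gf hE0.
have [_ bp cev u] := xE.
have [Q [q1 [q2 [hQ lq]]]] := pairing_hp hE hX.
have bQ : is_binprod qcb0 q1 q2 by apply: pairing_binprod => //; exact: qcb0_hp_qcb0.
have [a [b [[ca _ _] [cb _ _] ab ba]]] := binprod_iso bQ bp.
split=> //.
  have [_ cp1 cp2 up] := bp; split=> //; first exact: qcb0_hp_homeo ca cb ab ba hQ.
  by move=> Z h k /qcb0_hp_qcb0; exact: up.
move=> Z R s1 s2 h hZ bR ch; apply: u => //; first exact: qcb0_hp_qcb0.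
have [S [t1 [t2 [hS lS]]]] := pairing_hp hZ hX.
exact: binprod_transport qcb0_hp_qcb0 hS lS bR.
Qed.

(** ** Countable limits and colimits *)

Definition arrow (J : countable_category) : countType :=
  {i : J & {j : J & cc_hom i j}}.

Definition mk_arrow (J : countable_category) (i j : J) (u : cc_hom i j) : arrow J :=
  existT _ i (existT _ j u).

Lemma countably_complete_hp : countably_complete qcb0_hp.
Proof.
move=> J F hF; have [||L [p [GL lp]]] := @quiver_limit_ex J (arrow J) F
  (fun k => tag k) (fun k => tag (tagged k)) (fun k => dg_map (tagged (tagged k)))
  _ hyperprojective_closed.
- by move=> k; exact: dg_cont.
- by move=> i; apply/qcb0_of_hyperprojective.
exists L, p; split; first exact/qcb0_of_hyperprojective.
  split=> [|i j u]; first exact: (ql_cont lp).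
  apply/funext => l; exact: (ql_cone lp (mk_arrow u) l).
move=> Z f /qcb0_hp_qcb0 qZ [cf ff]; exact: (quiver_limit_universal lp).
Qed.

Lemma countably_cocomplete_hp : countably_cocomplete qcb0_hp.
Proof.
move=> J F hF; have [||L [c [GL cc ec uc]]] := @quiver_colimit_ex J (arrow J) F
  (fun k => tag k) (fun k => tag (tagged k)) (fun k => dg_map (tagged (tagged k)))
  _ hyperprojective_closed.
- by move=> k; exact: dg_cont.
- by move=> i; apply/qcb0_of_hyperprojective.
exists L, c; split; first exact/qcb0_of_hyperprojective.
  by split=> // i j u; exact: (ec (mk_arrow u)).
move=> Z f /qcb0_hp_qcb0 qZ [cf ff]; apply: uc => // k; exact: ff.
Qed.

Lemma terminal_hp : exists T : topologicalType, is_terminal qcb0_hp T.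
Proof.
have [|T [p [hT [_ _ uT]]]] := @product_ex void (fun k => match k with end).
  by case.
exists T; split=> // Z /qcb0_hp_qcb0 qZ.
have [|h [[ch _] uh]] := uT Z (fun k => match k with end) qZ; first by case.
by exists h; split=> // h' ch'; apply: uh; split=> // -[].
Qed.

Theorem theorem7p1 :
  (cartesian_closed qcb0_hp /\
   countably_complete qcb0_hp /\
   countably_cocomplete qcb0_hp) /\
  (inherits_exponentials qcb0_hp qcb0 /\
   inherits_countable_products qcb0_hp qcb0 /\
   inherits_countable_coproducts qcb0_hp qcb0 /\
   inherits_equalizers qcb0_hp qcb0 /\
   inherits_coequalizers qcb0_hp qcb0).
Proof.
split; first (split; last by split; [exact: countably_complete_hp|exact: countably_cocomplete_hp]).
  split; first exact: terminal_hp.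
    move=> X Y hX hY; have [P [p1 [p2 [hP lp]]]] := pairing_hp hX hY.
    by exists P, p1, p2; apply: pairing_binprod => //; exact: qcb0_hp_qcb0.
  move=> X Y hX hY; have [E [P [p1 [p2 [ev [xE _]]]]]] := exponential_ex hX hY.
  by exists E, P, p1, p2, ev.
split; [|split; [|split; [|split]]].
- move=> X Y hX hY; split; last by move=> *; exact: exponential_hp.
  have [E [P [p1 [p2 [ev [_ xE]]]]]] := exponential_ex hX hY.
  by exists E, P, p1, p2, ev.
- move=> I X hX; split; last by move=> *; exact: product_hp.
  by have [P [p [_ h]]] := product_ex hX; exists P, p.
- move=> I X hX; split; last by move=> *; exact: coproduct_hp.
  by have [P [p [_ h]]] := coproduct_ex hX; exists P, p.
- move=> X Y f g hX hY cf cg; split; last by move=> *; exact: equalizer_hp.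
  by have [P [p [_ h]]] := equalizer_ex hX hY cf cg; exists P, p.
- move=> X Y f g hX hY cf cg; split; last by move=> *; exact: coequalizer_hp.
  by have [P [p [_ h]]] := coequalizer_ex hX hY cf cg; exists P, p.
Qed.
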